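(* Let $\mathcal{A}$ be a tree automatic structure whose domain $\operatorname{dom}(\mathcal{A})\subseteq T_\Sigma$ is slim. Then $\mathcal{A}$ is word automatic, and a word automatic presentation of (a structure isomorphic to) $\mathcal{A}$ can be computed from a tree automatic presentation of $\mathcal{A}$.
   Context: A tree domain is a non-empty finite prefix-closed $D\subseteq\{0,1\}^\star$ with $u0\in D$ iff $u1\in D$ for all $u\in D$; a tree over the finite alphabet $\Sigma$ is a map $t\colon D\to\Sigma$ on a tree domain $D=\operatorname{dom}(t)$; $T_\Sigma$ is the set of trees. The thickness of $t$ is $\max_{\ell\ge0}|\operatorname{dom}(t)\cap\{0,1\}^\ell|$; a set of trees is slim if the thickness of its members is bounded by some $K\ge1$. Tree automata are deterministic bottom-up: $(Q,\iota,\delta,F)$ with $\iota\colon\Sigma\to Q$, $\delta\colon\Sigma\times Q\times Q\to Q$, state of a tree computed from the leaves up, accepting if in $F$. The convolution $\otimes(t_1,\dots,t_n)$ is the tree on $\bigcup_i\operatorname{dom}(t_i)$ labelled at $u$ by $(t'_1(u),\dots,t'_n(u))$ with $t'_i(u)=t_i(u)$ if defined and a padding symbol $\Box$ otherwise; a relation is automatic if the set of convolutions of its tuples is a regular tree language. A tree automatic structure is a relational structure whose domain is a regular subset of $T_\Sigma$ and whose relations are automatic; a tree automatic presentation is a tuple of tree automata recognising the domain and the convolutions of the relations. Word automatic structures/presentations are defined analogously using finite words, finite automata, and word convolution (pad with $\Box$ at the end); a structure is word automatic if isomorphic to a word automatic structure. *)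

(* Defs.v *)
From HB Require Import structures.
From mathcomp Require Import all_boot.

Set Implicit Arguments.
Unset Strict Implicit.
Unset Printing Implicit Defensive.

(** * Trees *)

(* Addresses are bit strings, [false] standing for 0 (left) and [true] for 1
   (right).  A map on a tree domain is represented by the full binary tree it
   describes; [label t] is the map itself, equal to [None] outside dom(t).
   The lemmas [label_domain], [label_inj] and [label_surj] say that [label] is
   a bijection from [tree S] onto the maps defined on a tree domain. *)
Inductive tree (S : Type) : Type :=
| Leaf of S
| Node of S & tree S & tree S.

Fixpoint label (S : Type) (t : tree S) (u : seq bool) : option S :=
  match u, t with
  | [::], Leaf a => Some a
  | [::], Node a _ _ => Some a
  | _ :: _, Leaf _ => None
  | b :: v, Node _ l r => if b then label r v else label l v
  end.

Record tree_domain (D : pred (seq bool)) : Prop := TreeDomain {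
  tdom_nil : D [::];
  tdom_fin : exists n, forall u, D u -> size u < n;
  tdom_prefix : forall u v, D (u ++ v) -> D u;
  tdom_sibling : forall u, D (rcons u false) = D (rcons u true) }.

Fixpoint height (S : Type) (t : tree S) : nat :=
  if t is Node _ l r then (maxn (height l) (height r)).+1 else 0.

Definition width (S : Type) (t : tree S) (l : nat) : nat :=
  #|[set u : l.-tuple bool | label t u : bool]|.

(* Levels beyond [height t] are empty, see [width_thickness]. *)
Definition thickness (S : Type) (t : tree S) : nat :=
  \max_(l < (height t).+1) width t l.

Definition slim (S : Type) (L : tree S -> Prop) : Prop :=
  exists2 K, 0 < K & forall t, L t -> thickness t <= K.

(* [is_conv ts s]: the tree s is the convolution of ts; the padding symbol is
   [None].  See [conv_exists] and [conv_unique]. *)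
Definition is_conv (S : Type) (n : nat) (ts : n.-tuple (tree S))
    (s : tree (n.-tuple (option S))) : Prop :=
  forall u, label s u =
    if has (fun t => label t u : bool) ts
    then Some [tuple of [seq label t u | t <- ts]] else None.

Record tree_aut (S : finType) : Type := TreeAut {
  ta_state : finType;
  ta_init : S -> ta_state;
  ta_delta : S -> ta_state -> ta_state -> ta_state;
  ta_final : {set ta_state} }.

Fixpoint tree_run (S : finType) (A : tree_aut S) (t : tree S) : ta_state A :=
  match t with
  | Leaf a => ta_init A a
  | Node a l r => ta_delta a (tree_run A l) (tree_run A r)
  end.

Definition tree_accepts (S : finType) (A : tree_aut S) (t : tree S) : bool :=
  tree_run A t \in ta_final A.

(** * Words *)

(* The padding symbol is again [None]. *)
Definition word_conv (G : Type) (n : nat) (ws : n.-tuple (seq G)) :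
    seq (n.-tuple (option G)) :=
  mkseq (fun i => [tuple of [seq onth w i | w <- ws]]) (\max_(w <- ws) size w).

Record word_aut (G : finType) : Type := WordAut {
  wa_state : finType;
  wa_init : wa_state;
  wa_delta : wa_state -> G -> wa_state;
  wa_final : {set wa_state} }.

Definition word_accepts (G : finType) (A : word_aut G) (w : seq G) : bool :=
  foldl (@wa_delta G A) (wa_init A) w \in wa_final A.

(** * Structures *)

(* Finite relational signatures.  Nullary symbols are excluded: the convolution
   of the empty tuple would have the empty set as domain. *)
Record signature : Type := Signature {
  arities :> seq nat;
  _ : all (leq 1) arities }.

Definition arity (sg : signature) (i : 'I_(size sg)) : nat := nth 0 sg i.

Record structure (sg : signature) (T : Type) : Type := Structure {
  dom : T -> Prop;
  rel : forall i : 'I_(size sg), (arity i).-tuple T -> Prop;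
  rel_dom : forall i (xs : (arity i).-tuple T),
    rel xs -> forall j, dom (tnth xs j) }.

Definition iso (sg : signature) (T U : Type)
    (A : structure sg T) (B : structure sg U) : Prop :=
  exists f : T -> U,
    [/\ forall x, dom A x -> dom B (f x),
        forall x y, dom A x -> dom A y -> f x = f y -> x = y,
        forall y, dom B y -> exists2 x, dom A x & f x = y
      & forall (i : 'I_(size sg)) (xs : (arity i).-tuple T),
          (forall j, dom A (tnth xs j)) ->
          (rel A xs <-> rel B [tuple of [seq f x | x <- xs]])].

(** * Automatic structures and their presentations *)

Definition tree_recognizes (S : finType) (M : tree_aut S)
    (L : tree S -> Prop) : Prop :=
  forall t, tree_accepts M t <-> L t.

Definition tree_conv_lang (S : Type) (n : nat)
    (R : n.-tuple (tree S) -> Prop) (s : tree (n.-tuple (option S))) : Prop :=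
  exists2 ts, R ts & is_conv ts s.

Definition tree_automatic (sg : signature) (S : finType)
    (A : structure sg (tree S)) : Prop :=
  (exists M : tree_aut S, tree_recognizes M (dom A)) /\
  forall i : 'I_(size sg), exists M : tree_aut ((arity i).-tuple (option S)),
    tree_recognizes M (tree_conv_lang (@rel _ _ A i)).

Record tree_pres (sg : signature) (S : finType) : Type := TreePres {
  tp_dom : tree_aut S;
  tp_rel : forall i : 'I_(size sg), tree_aut ((arity i).-tuple (option S)) }.

Definition tree_presents (sg : signature) (S : finType) (P : tree_pres sg S)
    (A : structure sg (tree S)) : Prop :=
  tree_recognizes (tp_dom P) (dom A) /\
  forall i, tree_recognizes (tp_rel P i) (tree_conv_lang (@rel _ _ A i)).

Definition word_recognizes (G : finType) (M : word_aut G)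
    (L : seq G -> Prop) : Prop :=
  forall w, word_accepts M w <-> L w.

Definition word_conv_lang (G : Type) (n : nat)
    (R : n.-tuple (seq G) -> Prop) (s : seq (n.-tuple (option G))) : Prop :=
  exists2 ws, R ws & s = word_conv ws.

Definition word_automatic_structure (sg : signature) (G : finType)
    (B : structure sg (seq G)) : Prop :=
  (exists M : word_aut G, word_recognizes M (dom B)) /\
  forall i : 'I_(size sg), exists M : word_aut ((arity i).-tuple (option G)),
    word_recognizes M (word_conv_lang (@rel _ _ B i)).

Definition word_automatic (sg : signature) (T : Type) (A : structure sg T) :
    Prop :=
  exists (G : finType) (B : structure sg (seq G)),
    word_automatic_structure B /\ iso A B.

Record word_pres (sg : signature) (G : finType) : Type := WordPres {
  wp_dom : word_aut G;
  wp_rel : forall i : 'I_(size sg), word_aut ((arity i).-tuple (option G)) }.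

Definition word_presents (sg : signature) (G : finType) (P : word_pres sg G)
    (B : structure sg (seq G)) : Prop :=
  word_recognizes (wp_dom P) (dom B) /\
  forall i, word_recognizes (wp_rel P i) (word_conv_lang (@rel _ _ B i)).

(** * Computability *)

(* The model of computation is a point-free form of Jones's WHILE language on
   S-expressions over one atom (N. D. Jones, Computability and Complexity from
   a Programming Perspective), which is Turing complete: a program denotes a
   partial function on [sexp], and [eval p x y] says that p halts on x with
   result y. *)
Inductive sexp : Type := Nil | Cons of sexp & sexp.

Definition hd (x : sexp) : sexp := if x is Cons a _ then a else Nil.
Definition tl (x : sexp) : sexp := if x is Cons _ b then b else Nil.

Inductive prog : Type :=
| PId
| PNil
| PHd
| PTl
| PPair of prog & prog
| PSeq of prog & prog
| PIf of prog & prog & prog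
| PWhile of prog & prog.

Inductive eval : prog -> sexp -> sexp -> Prop :=
| EvId x : eval PId x x
| EvNil x : eval PNil x Nil
| EvHd x : eval PHd x (hd x)
| EvTl x : eval PTl x (tl x)
| EvPair p q x y z :
    eval p x y -> eval q x z -> eval (PPair p q) x (Cons y z)
| EvSeq p q x y z :
    eval p x y -> eval q y z -> eval (PSeq p q) x z
| EvIfNil c p q x y :
    eval c x Nil -> eval q x y -> eval (PIf c p q) x y
| EvIfCons c p q x a b y :
    eval c x (Cons a b) -> eval p x y -> eval (PIf c p q) x y
| EvWhileStop c p x :
    eval c x Nil -> eval (PWhile c p) x x
| EvWhileStep c p x a b y z :
    eval c x (Cons a b) -> eval p x y -> eval (PWhile c p) y z ->
    eval (PWhile c p) x z.

(** ** Encoding presentations as S-expressions *)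

Definition code_nat (n : nat) : sexp := iter n (Cons Nil) Nil.

Definition code_seq (T : Type) (c : T -> sexp) (s : seq T) : sexp :=
  foldr (fun x d => Cons (c x) d) Nil s.

Definition code_fin (T : finType) (x : T) : sexp := code_nat (enum_rank x).

(* The padding symbol is coded by 0 and the letters by 1, 2, etc. *)
Definition code_padded (T : finType) (o : option T) : sexp :=
  if o is Some a then code_nat (enum_rank a).+1 else code_nat 0.

Definition code_letter (T : finType) (n : nat) (x : n.-tuple (option T)) :
    sexp :=
  code_seq (@code_padded T) x.

(* All n-tuples of padded letters in lexicographic order.  Mathcomp's [enum] on
   tuples is sealed, so nothing can be proved about the order of its result.  See
   [mem_letters] and [letters_uniq]. *)
Fixpoint tuples (T : Type) (s : seq T) (n : nat) : seq (n.-tuple T) :=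
  if n is m.+1
  then [seq cons_tuple x t | x <- s, t <- tuples s m]
  else [:: [tuple]].

Definition letters (T : finType) (n : nat) : seq (n.-tuple (option T)) :=
  tuples (None :: map Some (enum T)) n.

(* An automaton is coded by its number of states, its initial state(s), its
   transition table and its list of final states; [ls] lists the alphabet and
   [c] codes the letters. *)
Definition code_tree_aut (S : finType) (ls : seq S) (c : S -> sexp)
    (A : tree_aut S) : sexp :=
  let Q := enum (ta_state A) in
  Cons (code_nat #|ta_state A|)
  (Cons (code_seq (fun a => Cons (c a) (code_fin (ta_init A a))) ls)
  (Cons (code_seq id
           [seq code_seq id
                  [:: c a; code_fin pq.1; code_fin pq.2;
                      code_fin (ta_delta a pq.1 pq.2)]
           | a <- ls, pq <- [seq (p, q) | p <- Q, q <- Q]])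
        (code_seq (@code_fin _) (enum (ta_final A))))).

Definition code_word_aut (G : finType) (ls : seq G) (c : G -> sexp)
    (A : word_aut G) : sexp :=
  Cons (code_nat #|wa_state A|)
  (Cons (code_fin (wa_init A))
  (Cons (code_seq id
           [seq code_seq id [:: code_fin p; c a; code_fin (wa_delta p a)]
           | p <- enum (wa_state A), a <- ls])
        (code_seq (@code_fin _) (enum (wa_final A))))).

(* A presentation is coded by the size of its alphabet, the automaton for the
   domain, and the list of arities paired with the automata for the relations. *)
Definition code_tree_pres (sg : signature) (S : finType) (P : tree_pres sg S) :
    sexp :=
  Cons (code_nat #|S|)
  (Cons (code_tree_aut (enum S) (@code_fin S) (tp_dom P))
        (code_seq
           (fun i => Cons (code_nat (arity i))
                       (code_tree_aut (letters S (arity i))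
                          (@code_letter S (arity i)) (tp_rel P i)))
           (enum 'I_(size sg)))).

Definition code_word_pres (sg : signature) (G : finType) (P : word_pres sg G) :
    sexp :=
  Cons (code_nat #|G|)
  (Cons (code_word_aut (enum G) (@code_fin G) (wp_dom P))
        (code_seq
           (fun i => Cons (code_nat (arity i))
                       (code_word_aut (letters G (arity i))
                          (@code_letter G (arity i)) (wp_rel P i)))
           (enum 'I_(size sg)))).

(** * Adequacy of the encodings *)

Lemma label_height (S : Type) (t : tree S) u : label t u -> size u <= height t.
Proof.
elim: t u => [a|a l IHl r IHr] [|b u] //=.
by case: b => [/IHr|/IHl] H; rewrite ltnS leq_max H ?orbT.
Qed.

Lemma width_thickness (S : Type) (t : tree S) l : width t l <= thickness t.
Proof.
have [lt_l|gt_l] := ltnP l (height t).+1.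
  exact: (@leq_bigmax _ (fun i : 'I_(height t).+1 => width t i) (Ordinal lt_l)).
rewrite /width (_ : [set u | _] = set0) ?cards0 //; apply/setP => u.
by rewrite !inE; apply: contraTF gt_l => /label_height; rewrite size_tuple -leqNgt.
Qed.

Lemma label_domain (S : Type) (t : tree S) : tree_domain (fun u => label t u).
Proof.
split; first by case: t.
- by exists (height t).+1 => u /label_height.
- elim: t => [a|a l IHl r IHr] [|b u] v //=.
  by case: b; [apply: IHr|apply: IHl].
- elim: t => [a|a l IHl r IHr] [|b u] //=; first by case: l {IHl}; case: r {IHr}.
  by case: b; rewrite ?IHl ?IHr.
Qed.

Lemma label_inj (S : Type) (t t' : tree S) : label t =1 label t' -> t = t'.
Proof.
elim: t t' => [a|a l IHl r IHr] [b|b l' r'] E.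
- by case: (E [::]) => ->.
- by have := E [:: true]; case: r' {E}.
- by have := E [:: true]; case: r {IHr E}.
- case: (E [::]) => ->.
  by rewrite (IHl l') => [|u]; [rewrite (IHr r') // => u|];
     [apply: (E (true :: u))|apply: (E (false :: u))].
Qed.

Lemma label_surj (S : Type) (f : seq bool -> option S) :
  tree_domain (fun u => f u) -> exists t, label t =1 f.
Proof.
case=> f0 [n]; elim: n f f0 => [|n IHn] f f0 fin pre sib.
  by have := fin [::] f0.
case E0: (f [::]) f0 => [a|//] _.
case Ef: (f [:: false] : bool); last first.
  exists (Leaf a) => -[|b u] /=; first by rewrite E0.
  case Eu: (f (b :: u)) => [c|//].
  have : f [:: b] by apply: (pre [:: b] u); rewrite /= Eu.
  by case: b {Eu}; rewrite -?(sib [::]) Ef.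
have IH b : exists t, label t =1 (fun u => f (b :: u)).
  apply: IHn => [||u v|u]; first by case: b; rewrite -?(sib [::]) Ef.
  - by move=> u /fin.
  - exact: (pre (b :: u) v).
  - exact: (sib (b :: u)).
have [[l El] [r Er]] := (IH false, IH true).
by exists (Node a l r) => -[|[] u] /=; rewrite ?El ?Er ?E0.
Qed.

Lemma conv_exists (S : Type) (n : nat) (ts : n.-tuple (tree S)) :
  0 < n -> exists s, is_conv ts s.
Proof.
move=> n0; pose D u := has (fun t => label t u : bool) ts.
have [|s Es] := @label_surj _ (fun u =>
  if D u then Some [tuple of [seq label t u | t <- ts]] else None);
  last by exists s.
have DE u : (if D u then Some [tuple of [seq label t u | t <- ts]] else None)
  = D u :> bool by case: (D u).
split=> [||u v|u]; rewrite ?DE /D.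
- case: ts n0 {D DE} => -[|t ts] /= /eqP <- // _.
  by have [-> ] := label_domain t.
- exists (\max_(t <- ts) height t).+1 => u; rewrite DE /D => H.
  rewrite ltnS; elim: {D DE} (tval ts) H => //= t s IH.
  rewrite big_cons => /orP[/label_height|/IH] H; rewrite (leq_trans H) //.
    exact: leq_maxl.
  exact: leq_maxr.
- by apply: sub_has => t; have [_ _ + _] := label_domain t; apply.
- by apply: eq_has => t; have [_ _ _ +] := label_domain t; apply.
Qed.

Lemma conv_unique (S : Type) (n : nat) (ts : n.-tuple (tree S)) s s' :
  is_conv ts s -> is_conv ts s' -> s = s'.
Proof. by move=> H H'; apply: label_inj => u; rewrite H H'. Qed.

Lemma mem_letters (T : finType) n (x : n.-tuple (option T)) :
  x \in letters T n.
Proof.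
rewrite /letters; elim: n x => [|n IHn] x; first by rewrite (tuple0 x) inE.
case/tupleP: x => a x; apply/allpairsP; exists (a, x); split => //=.
by case: a => [a|]; rewrite inE //= map_f // mem_enum.
Qed.

Lemma letters_uniq (T : finType) n : uniq (letters T n).
Proof.
have Us : uniq (None :: [seq Some x | x <- enum T]).
  rewrite /= map_inj_uniq ?enum_uniq ?andbT; last by move=> x y [].
  by apply/mapP => -[].
rewrite /letters; elim: n => [//|n IHn]; apply: allpairs_uniq => //.
by move=> [a x] [b y] _ _ /= [-> /val_inj ->].
Qed.

Lemma eval_det p x y z : eval p x y -> eval p x z -> y = z.
Proof.
move=> H; elim: H z => {p x y};
  try by [move=> x z H; inversion H].
- by move=> p q x y z _ IHp _ IHq w H; inversion H; subst; f_equal; auto.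
- move=> p q x y z _ IHp _ IHq w H; inversion H; subst.
  by apply: IHq; match goal with Hp : eval p x _ |- _ => rewrite (IHp _ Hp) end.
- move=> c p q x y _ IHc _ IHq w H; inversion H; subst; first exact: IHq.
  by match goal with Hc : eval c x _ |- _ => have := IHc _ Hc end.
- move=> c p q x a b y _ IHc _ IHp w H; inversion H; subst; last exact: IHp.
  by match goal with Hc : eval c x _ |- _ => have := IHc _ Hc end.
- move=> c p x _ IHc w H; inversion H; subst => //.
  by match goal with Hc : eval c x _ |- _ => have := IHc _ Hc end.
- move=> c p x a b y z _ IHc _ IHp _ IHw w H; inversion H; subst.
    by match goal with Hc : eval c _ Nil |- _ => have := IHc _ Hc end.
  by apply: IHw; match goal with Hp : eval p x _ |- _ => rewrite (IHp _ Hp) end.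
Qed.

(* Main.v *)
(** A tree is written as the word of its levels, each level being the list of
    the labels of its nodes from left to right, with one bit per node telling
    whether it has children; this determines the tree.  Slimness bounds the
    levels, hence the alphabet.

    A word automaton reads a tuple of such words top-down, guessing the states
    of the tree automaton: its state is the frontier of the convolution, i.e.
    the sequence of the nodes of the current level, each with the set of
    components it belongs to and a guessed state.  Frontiers have bounded
    length, and the powerset construction makes the automaton deterministic.

    A bound on the width is computed from the number m of states by pumping.  A
    state of a tree of height at least m is the state of arbitrarily high trees.
    If two nodes of a path had the same state, and both children of the upper
    one were that high, repeating the segment between them and pumping the tree
    beside it would make the width unbounded.  Hence there are at most m such
    branchings on a path, and the width is at most 2^m * 2^m.

    The translation is a function on numbers, pairs and lists, built from
    operations for which WHILE programs are exhibited. *)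

Require Import Defs.
From mathcomp Require Import all_boot.
Import Defs.

Set Implicit Arguments.
Unset Strict Implicit.
Unset Printing Implicit Defensive.

(** * Computable functions *)

Class Enc (T : Type) := enc : T -> sexp.

#[global] Instance enc_unit : Enc unit := fun=> Nil.
#[global] Instance enc_nat : Enc nat := code_nat.
#[global] Instance enc_bool : Enc bool := fun b => if b then Cons Nil Nil else Nil.
#[global] Instance enc_option T (_ : Enc T) : Enc (option T) :=
  fun o => if o is Some x then Cons Nil (enc x) else Nil.
#[global] Instance enc_pair T U (_ : Enc T) (_ : Enc U) : Enc (T * U) :=
  fun x => Cons (enc x.1) (enc x.2).
#[global] Instance enc_seq T (_ : Enc T) : Enc (seq T) := code_seq enc.

(** WHILE programs have no variables. In the closure lemmas below the type [E] is therefore an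
    environment that holds the values of the free variables of functional arguments. *)
Definition computable T U {eT : Enc T} {eU : Enc U} (f : T -> U) : Prop :=
  exists p, forall x, eval p (enc x) (enc (f x)).

Section Basic.
Context {E T U : Type} {eE : Enc E} {eT : Enc T} {eU : Enc U}.

Lemma computable_ext (f g : E -> T) : f =1 g -> computable g -> computable f.
Proof. by move=> fg [p Hp]; exists p => x; rewrite fg. Qed.

Lemma computable_comp (f : T -> U) (g : E -> T) :
  computable f -> computable g -> computable (fun e => f (g e)).
Proof. by move=> [p Hp] [q Hq]; exists (PSeq q p) => x; apply: EvSeq. Qed.

Lemma computable_id : computable (fun e : E => e).
Proof. by exists PId => x; constructor. Qed.

Lemma computable_const (a : T) : computable (fun _ : E => a).
Proof.
suff [p Hp] : exists p, forall x, eval p x (@enc T eT a) by exists p => x; apply: Hp.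
elim: (@enc T eT a) => [|y [p Hp] z [q Hq]]; first by exists PNil; constructor.
by exists (PPair p q) => x; constructor.
Qed.

Lemma computable_pair (f : E -> T) (g : E -> U) :
  computable f -> computable g -> computable (fun e => (f e, g e)).
Proof. by move=> [p Hp] [q Hq]; exists (PPair p q) => x; constructor. Qed.

Lemma computable_fst (f : E -> T * U) : computable f -> computable (fun e => (f e).1).
Proof.
move=> [p Hp]; exists (PSeq p PHd) => x.
by apply: EvSeq (Hp x) _; apply: (EvHd (enc (f x))).
Qed.

Lemma computable_snd (f : E -> T * U) : computable f -> computable (fun e => (f e).2).
Proof.
move=> [p Hp]; exists (PSeq p PTl) => x.
by apply: EvSeq (Hp x) _; apply: (EvTl (enc (f x))).
Qed.

Lemma computable_if (b : E -> bool) (f g : E -> T) :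
  computable b -> computable f -> computable g ->
  computable (fun e => if b e then f e else g e).
Proof.
move=> [c Hc] [p Hp] [q Hq]; exists (PIf c p q) => x.
have := Hc x; case: (b x) => /= H; first exact: EvIfCons H (Hp x).
exact: EvIfNil H (Hq x).
Qed.

Lemma computable_cons (f : E -> T) (g : E -> seq T) :
  computable f -> computable g -> computable (fun e => f e :: g e).
Proof. by move=> [p Hp] [q Hq]; exists (PPair p q) => x; constructor. Qed.

Lemma computable_some (f : E -> T) : computable f -> computable (fun e => Some (f e)).
Proof. by move=> [p Hp]; exists (PPair PNil p) => x; constructor => //; constructor. Qed.

Lemma computable_S (f : E -> nat) : computable f -> computable (fun e => (f e).+1).
Proof. by move=> [p Hp]; exists (PPair PNil p) => x; constructor => //; constructor. Qed.

Lemma computable_pred (f : E -> nat) : computable f -> computable (fun e => (f e).-1).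
Proof.
move=> [p Hp]; exists (PSeq p PTl) => x; apply: EvSeq (Hp x) _.
have -> : enc (f x).-1 = tl (enc (f x)) by case: (f x).
exact: EvTl.
Qed.

Lemma computable_behead (f : E -> seq T) :
  computable f -> computable (fun e => behead (f e)).
Proof.
move=> [p Hp]; exists (PSeq p PTl) => x; apply: EvSeq (Hp x) _.
have -> : enc (behead (f x)) = tl (enc (f x)) by case: (f x).
exact: EvTl.
Qed.

Lemma computable_oapp (s : E -> option T) (f : E -> U) (g : E -> T -> U) :
  computable s -> computable f ->
  computable (fun p : E * T => g p.1 p.2) ->
  computable (fun e => oapp (g e) (f e) (s e)).
Proof.
move=> [ps Hs] [pf Hf] [pg Hg].
exists (PIf ps (PSeq (PPair PId (PSeq ps PTl)) pg) pf) => e.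
have := Hs e; case: (s e) => [x|] /= H; last exact: EvIfNil H (Hf e).
have {}H : eval ps (enc e) (Cons Nil (enc x)) by [].
refine (EvIfCons _ H _); apply: EvSeq (Hg (e, x)).
exact: EvPair (EvId _) (EvSeq H (EvTl (Cons Nil (enc x)))).
Qed.

(** The state of the loop consists of the unread list, the accumulator and the environment, which
    [f] needs in every round. The loop stops when the list has become [Nil]. *)
Lemma computable_foldl (f : E -> T -> U -> T) (a : E -> T) (s : E -> seq U) :
  computable (fun p : E * (T * U) => f p.1 p.2.1 p.2.2) ->
  computable a -> computable s ->
  computable (fun e => foldl (f e) (a e) (s e)).
Proof.
move=> [pf Hf] [pa Ha] [ps Hs].
pose body := PPair (PSeq PHd PTl) (PPair (PSeq (PPair (PSeq PTl PTl)
  (PPair (PSeq PTl PHd) (PSeq PHd PHd))) pf) (PSeq PTl PTl)).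
exists (PSeq (PPair ps (PPair pa PId)) (PSeq (PWhile PHd body) (PSeq PTl PHd))) => e.
have H t b : eval (PWhile PHd body) (Cons (enc t) (Cons (enc b) (enc e)))
   (Cons Nil (Cons (enc (foldl (f e) b t)) (enc e))).
  elim: t b => [|x t IH] b; first by apply: EvWhileStop; apply: (EvHd (Cons Nil _)).
  pose st := Cons (Cons (eU x) (code_seq eU t)) (Cons (eT b) (eE e)).
  have e_st : eval (PSeq PTl PTl) st (enc e).
    exact: (EvSeq (EvTl st) (EvTl (tl st))).
  have b_st : eval (PSeq PTl PHd) st (enc b).
    exact: (EvSeq (EvTl st) (EvHd (tl st))).
  have x_st : eval (PSeq PHd PHd) st (enc x).
    exact: (EvSeq (EvHd st) (EvHd (hd st))).
  have t_st : eval (PSeq PHd PTl) st (enc t).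
    exact: (EvSeq (EvHd st) (EvTl (hd st))).
  apply: (@EvWhileStep _ _ _ (enc x) (enc t) _ _ (EvHd st) _ (IH (f e b x))).
  apply: (EvPair t_st (EvPair (EvSeq _ (Hf (e, (b, x)))) e_st)).
  exact: (EvPair e_st (EvPair b_st x_st)).
apply: (EvSeq (EvPair (Hs e) (EvPair (Ha e) (EvId _)))).
exact: (EvSeq (H (s e) (a e)) (EvSeq (EvTl _) (EvHd _))).
Qed.

End Basic.

Lemma computable_app2 E A B C {eE : Enc E} {eA : Enc A} {eB : Enc B} {eC : Enc C}
    (f : A -> B -> C) (a : E -> A) (b : E -> B) :
  computable (fun p : A * B => f p.1 p.2) -> computable a -> computable b ->
  computable (fun e => f (a e) (b e)).
Proof.
move=> Hf Ha Hb.
exact: (computable_comp (g := fun e => (a e, b e)) Hf (computable_pair Ha Hb)).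
Qed.

Lemma computable_app3 E A B C D {eE : Enc E} {eA : Enc A} {eB : Enc B} {eC : Enc C}
    {eD : Enc D} (f : A -> B -> C -> D) (a : E -> A) (b : E -> B) (c : E -> C) :
  computable (fun p : A * (B * C) => f p.1 p.2.1 p.2.2) ->
  computable a -> computable b -> computable c ->
  computable (fun e => f (a e) (b e) (c e)).
Proof.
move=> Hf Ha Hb Hc.
exact: (computable_comp (g := fun e => (a e, (b e, c e))) Hf
  (computable_pair Ha (computable_pair Hb Hc))).
Qed.

Ltac comp_fold := fail.
Ltac comp_list := fail.
Ltac comp_arith := fail.
Ltac comp_eq := fail.
Ltac comp_words := fail.
Ltac comp_tables := fail.
Ltac comp_power := fail.

(* The empty hooks above are filled in with [::=] as closure lemmas are proved. *)
Ltac comp_step := lazymatch goal with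
  | |- computable (fun e => e) => exact computable_id
  | |- computable (fun _ => ?a) => exact (computable_const a)
  | |- computable fst => exact (computable_fst computable_id)
  | |- computable snd => exact (computable_snd computable_id)
  | |- computable (fun e => fst (@?f e)) => refine (computable_fst _)
  | |- computable (fun e => snd (@?f e)) => refine (computable_snd _)
  | |- computable (fun e => (@?f e, @?g e)) => refine (computable_pair _ _)
  | |- computable (fun e => @?f e :: @?g e) => refine (computable_cons _ _)
  | |- computable (fun e => Some (@?f e)) => refine (computable_some _)
  | |- computable (fun e => (@?f e).+1) => refine (computable_S _)
  | |- computable (fun e => (@?f e).-1) => refine (computable_pred _)
  | |- computable (fun e => behead (@?f e)) => refine (computable_behead _)
  | |- computable (fun e => if _ then _ else _) => refine (computable_if _ _ _)
  | |- computable (fun e => oapp _ _ _) => refine (computable_oapp _ _ _)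
  | |- computable (fun e => foldl _ _ _) => refine (computable_foldl _ _ _)
  | |- _ => first
      [ assumption | comp_fold | comp_list | comp_arith | comp_eq
      | comp_words | comp_tables | comp_power
      | match goal with
        | H : computable ?a |- computable (fun e => ?a _) => refine (computable_comp H _)
        | H : computable (fun p => _ (fst p) (snd p)) |- _ => refine (computable_app2 H _ _)
        | H : computable (fun p => _ (fst p) (fst (snd p)) (snd (snd p))) |- _ =>
            refine (computable_app3 H _ _ _)
        end ]
  end.
Ltac comp := repeat (lazy beta; comp_step).

Lemma computable_rev E T {eE : Enc E} {eT : Enc T} (s : E -> seq T) :
  computable s -> computable (fun e => rev (s e)).
Proof.
move=> Hs; apply: (@computable_ext _ _ _ _ _ (fun e => foldl (fun r x => x :: r) [::] (s e))).
  by move=> e; rewrite /rev; elim: (s e) [::] => //= x t IH r; apply: IH.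
by comp.
Qed.

Lemma computable_foldr E T U {eE : Enc E} {eT : Enc T} {eU : Enc U}
    (f : E -> U -> T -> T) (a : E -> T) (s : E -> seq U) :
  computable (fun p : E * (U * T) => f p.1 p.2.1 p.2.2) ->
  computable a -> computable s ->
  computable (fun e => foldr (f e) (a e) (s e)).
Proof.
move=> Hf Ha Hs.
apply: (@computable_ext _ _ _ _ _ (fun e => foldl (fun b x => f e x b) (a e) (rev (s e)))).
  by move=> e; rewrite -foldl_rev.
by comp; apply: computable_rev.
Qed.

Ltac comp_fold ::= lazymatch goal with
  | |- computable (fun e => foldr _ _ _) => refine (computable_foldr _ _ _)
  end.

Lemma computable_map E T U {eE : Enc E} {eT : Enc T} {eU : Enc U}
    (f : E -> T -> U) (s : E -> seq T) :
  computable (fun p : E * T => f p.1 p.2) -> computable s ->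
  computable (fun e => map (f e) (s e)).
Proof.
move=> Hf Hs.
apply: (@computable_ext _ _ _ _ _ (fun e => foldr (fun x r => f e x :: r) [::] (s e))).
  by move=> e; elim: (s e) => //= x t ->.
by comp.
Qed.

Section Lists.
Context {E T U : Type} {eE : Enc E} {eT : Enc T} {eU : Enc U}.

Lemma computable_filter (f : E -> T -> bool) (s : E -> seq T) :
  computable (fun p : E * T => f p.1 p.2) -> computable s ->
  computable (fun e => filter (f e) (s e)).
Proof.
move=> Hf Hs; apply: (@computable_ext _ _ _ _ _
  (fun e => foldr (fun x r => if f e x then x :: r else r) [::] (s e))).
  by move=> e; elim: (s e) => //= x t ->.
by comp.
Qed.

Lemma computable_has (f : E -> T -> bool) (s : E -> seq T) :
  computable (fun p : E * T => f p.1 p.2) -> computable s ->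
  computable (fun e => has (f e) (s e)).
Proof.
move=> Hf Hs; apply: (@computable_ext _ _ _ _ _
  (fun e => foldr (fun x r => if f e x then true else r) false (s e))).
  by move=> e; elim: (s e) => //= x t ->.
by comp.
Qed.

Lemma computable_all (f : E -> T -> bool) (s : E -> seq T) :
  computable (fun p : E * T => f p.1 p.2) -> computable s ->
  computable (fun e => all (f e) (s e)).
Proof.
move=> Hf Hs; apply: (@computable_ext _ _ _ _ _
  (fun e => foldr (fun x r => if f e x then r else false) true (s e))).
  by move=> e; elim: (s e) => //= x t ->.
by comp.
Qed.

Lemma computable_cat (s t : E -> seq T) :
  computable s -> computable t -> computable (fun e => s e ++ t e).
Proof.
move=> Hs Ht; apply: (@computable_ext _ _ _ _ _
  (fun e => foldr (fun x r => x :: r) (t e) (s e))).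
  by move=> e; elim: (s e) => //= x u ->.
by comp.
Qed.

Lemma computable_size (s : E -> seq T) : computable s -> computable (fun e => size (s e)).
Proof.
move=> Hs; apply: (@computable_ext _ _ _ _ _ (fun e => foldr (fun _ n => n.+1) 0 (s e))).
  by move=> e; elim: (s e) => //= x u ->.
by comp.
Qed.

Lemma computable_nilp (s : E -> seq T) : computable s -> computable (fun e => nilp (s e)).
Proof.
move=> Hs; apply: (@computable_ext _ _ _ _ _ (fun e => foldr (fun _ _ => false) true (s e))).
  by move=> e; case: (s e).
by comp.
Qed.

Lemma computable_ohead (s : E -> seq T) : computable s -> computable (fun e => ohead (s e)).
Proof.
move=> Hs; apply: (@computable_ext _ _ _ _ _ (fun e => foldr (fun x _ => Some x) None (s e))).
  by move=> e; case: (s e).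
by comp.
Qed.

Lemma computable_head (a : E -> T) (s : E -> seq T) :
  computable a -> computable s -> computable (fun e => head (a e) (s e)).
Proof.
move=> Ha Hs; apply: (@computable_ext _ _ _ _ _ (fun e => foldr (fun x _ => x) (a e) (s e))).
  by move=> e; case: (s e).
by comp.
Qed.

(** A number and the list of that many units have the same code, so one program serves for both.
    This reduces iteration to folding over a list. *)
Lemma computable_nseq_tt (n : E -> nat) :
  computable n -> computable (fun e => nseq (n e) tt).
Proof.
move=> [p Hp]; exists p => e.
have E2 m : code_nat m = code_seq enc_unit (nseq m tt) by elim: m => //= m <-.
by have := Hp e; rewrite /enc /enc_nat /enc_seq E2.
Qed.

Lemma computable_iter (n : E -> nat) (f : E -> T -> T) (a : E -> T) :
  computable n -> computable (fun p : E * T => f p.1 p.2) -> computable a ->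
  computable (fun e => iter (n e) (f e) (a e)).
Proof.
move=> /computable_nseq_tt Hn Hf Ha; apply: (@computable_ext _ _ _ _ _
  (fun e => foldr (fun _ x => f e x) (a e) (nseq (n e) tt))).
  by move=> e; elim: (n e) => //= m ->.
by comp.
Qed.

End Lists.

Ltac comp_list ::= lazymatch goal with
  | |- computable (fun e => map _ _) => refine (computable_map _ _)
  | |- computable (fun e => filter _ _) => refine (computable_filter _ _)
  | |- computable (fun e => has _ _) => refine (computable_has _ _)
  | |- computable (fun e => all _ _) => refine (computable_all _ _)
  | |- computable (fun e => cat _ _) => refine (computable_cat _ _)
  | |- computable (fun e => size _) => refine (computable_size _)
  | |- computable (fun e => nilp _) => refine (computable_nilp _)
  | |- computable (fun e => ohead _) => refine (computable_ohead _)
  | |- computable (fun e => head _ _) => refine (computable_head _ _)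
  | |- computable (fun e => iter _ _ _) => refine (computable_iter _ _ _)
  end.

Section Derived.
Context {E T U : Type} {eE : Enc E} {eT : Enc T} {eU : Enc U}.

Lemma computable_negb (a : E -> bool) : computable a -> computable (fun e => ~~ a e).
Proof. by move=> Ha; rewrite /negb; comp. Qed.

Lemma computable_andb (a b : E -> bool) :
  computable a -> computable b -> computable (fun e => a e && b e).
Proof. by move=> Ha Hb; rewrite /andb; comp. Qed.

Lemma computable_flatten (s : E -> seq (seq T)) :
  computable s -> computable (fun e => flatten (s e)).
Proof. by move=> Hs; rewrite /flatten; comp. Qed.

Lemma computable_nth (a : E -> T) (s : E -> seq T) (n : E -> nat) :
  computable a -> computable s -> computable n ->
  computable (fun e => nth (a e) (s e) (n e)).
Proof.
move=> Ha Hs Hn; apply: (@computable_ext _ _ _ _ _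
  (fun e => head (a e) (iter (n e) (fun r => behead r) (s e)))).
  move=> e; elim: (n e) (s e) => [|m IH] [|x u] //=; last by rewrite IH -iterS iterSr.
  by rewrite (_ : iter m _ _ = [::]) //; elim: m {IH} => //= m ->.
by comp.
Qed.

Lemma computable_nseq (a : E -> T) (n : E -> nat) :
  computable a -> computable n -> computable (fun e => nseq (n e) (a e)).
Proof.
move=> Ha Hn; apply: (@computable_ext _ _ _ _ _
  (fun e => iter (n e) (fun r => a e :: r) [::])).
  by move=> e; elim: (n e) => //= m ->.
by comp.
Qed.

Lemma computable_iota0 (n : E -> nat) : computable n -> computable (fun e => iota 0 (n e)).
Proof.
move=> Hn; apply: (@computable_ext _ _ _ _ _
  (fun e => iter (n e) (fun r => 0 :: map (fun x => x.+1) r) [::])).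
  by move=> e; elim: (n e) => //= m <-; rewrite -(addn0 1) iotaDl.
by comp.
Qed.

Lemma computable_addn (m n : E -> nat) :
  computable m -> computable n -> computable (fun e => m e + n e).
Proof.
move=> Hm Hn; apply: (@computable_ext _ _ _ _ _
  (fun e => iter (m e) (fun r => r.+1) (n e))).
  by move=> e; elim: (m e) => //= k <-.
by comp.
Qed.

End Derived.

Lemma computable_muln E {eE : Enc E} (m n : E -> nat) :
  computable m -> computable n -> computable (fun e => m e * n e).
Proof.
move=> Hm Hn; apply: (@computable_ext _ _ _ _ _
  (fun e => iter (m e) (fun r => n e + r) 0)).
  by move=> e; elim: (m e) => //= k <-; rewrite mulSn.
by comp; apply: computable_addn; comp.
Qed.

Class CEq (T : eqType) {eT : Enc T} :=
  ceq : computable (fun p : T * T => p.1 == p.2).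
Arguments CEq T {eT}.

Lemma computable_eq E (T : eqType) {eE : Enc E} {eT : Enc T} {cT : CEq T} (a b : E -> T) :
  computable a -> computable b -> computable (fun e => a e == b e).
Proof. exact: (computable_app2 ceq). Qed.

Ltac comp_arith ::= lazymatch goal with
  | |- computable (fun e => ~~ _) => refine (computable_negb _)
  | |- computable (fun e => _ && _) => refine (computable_andb _ _)
  | |- computable (fun e => flatten _) => refine (computable_flatten _)
  | |- computable (fun e => nth _ _ _) => refine (computable_nth _ _ _)
  | |- computable (fun e => nseq _ _) => refine (computable_nseq _ _)
  | |- computable (fun e => iota 0 _) => refine (computable_iota0 _)
  | |- computable (fun e => _ + _) => refine (computable_addn _ _)
  | |- computable (fun e => _ * _) => refine (computable_muln _ _)
  | |- computable (fun e => eq_op _ _) => refine (computable_eq _ _)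
  end.

#[global] Instance ceq_unit : CEq unit.
Proof. by apply: computable_ext (computable_const true) => -[[] []]. Qed.

#[global] Instance ceq_bool : CEq bool.
Proof.
apply: (@computable_ext _ _ _ _ _ (fun p : bool * bool => if p.1 then p.2 else ~~ p.2)).
  by case=> [[] []].
by comp.
Qed.

#[global] Instance ceq_pair (T U : eqType) (eT : Enc T) (eU : Enc U)
  (cT : CEq T) (cU : CEq U) : CEq (T * U)%type.
Proof.
apply: (@computable_ext _ _ _ _ _ (fun p : (T * U) * (T * U) =>
  (p.1.1 == p.2.1) && (p.1.2 == p.2.2))) => //.
by comp.
Qed.

#[global] Instance ceq_option (T : eqType) (eT : Enc T) (cT : CEq T) :
  CEq (option T).
Proof.
apply: (@computable_ext _ _ _ _ _ (fun p : option T * option T =>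
  oapp (fun x => oapp (fun y => x == y) false p.2)
       (oapp (fun=> false) true p.2) p.1)); first by move=> [[x|] [y|]].
by comp.
Qed.

(** The fold over the first list removes one entry of the second in each round and records whether
    the two entries agreed. A rest of the second list is detected at the end. *)
#[global] Instance ceq_seq (T : eqType) (eT : Enc T) (cT : CEq T) : CEq (seq T).
Proof.
pose step (a : seq T * bool) x := (behead a.1, a.2 && (ohead a.1 == Some x)).
apply: (@computable_ext _ _ _ _ _ (fun p : seq T * seq T =>
  let r := foldl step (p.2, true) p.1 in r.2 && nilp r.1)).
  case=> s t /=; rewrite -[LHS]andTb; elim: s t true => [|x s IH] [|y t] b //=.
  - by rewrite -IH !andbF.
  - by rewrite -IH eqseq_cons eq_sym andbA.
by rewrite /step /=; comp.
Qed.

#[global] Instance ceq_nat : CEq nat.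
Proof.
apply: (@computable_ext _ _ _ _ _ (fun p : nat * nat => nseq p.1 tt == nseq p.2 tt)).
  by case=> m n /=; elim: m n => [|m IH] [|n] //=; rewrite eqSS IH.
by comp.
Qed.

Section DerivedEq.
Context {E : Type} {T : eqType} {eE : Enc E} {eT : Enc T} {cT : CEq T}.

Lemma computable_mem (x : E -> T) (s : E -> seq T) :
  computable x -> computable s -> computable (fun e => x e \in s e).
Proof.
move=> Hx Hs; apply: (@computable_ext _ _ _ _ _ (fun e => has (fun y => y == x e) (s e))).
  by move=> e; rewrite has_pred1.
by comp.
Qed.

Lemma computable_index (x : E -> T) (s : E -> seq T) :
  computable x -> computable s -> computable (fun e => index (x e) (s e)).
Proof.
move=> Hx Hs; apply: (@computable_ext _ _ _ _ _
  (fun e => foldr (fun y n => if y == x e then 0 else n.+1) 0 (s e))).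
  by move=> e; elim: (s e) => //= y s' ->.
by comp.
Qed.

End DerivedEq.

Ltac comp_eq ::= lazymatch goal with
  | |- computable (fun e => in_mem _ _) => refine (computable_mem _ _)
  | |- computable (fun e => index _ _) => refine (computable_index _ _)
  end.

(** * The width of the trees of a slim regular language *)

Section Width.
Variable S : Type.
Implicit Types t l r : tree S.

Lemma width0 t : width t 0 = 1.
Proof.
rewrite /width (_ : [set u | _] = setT) ?cardsT ?card_tuple //.
by apply/setP => u; rewrite !inE tuple0; case: t.
Qed.

Lemma width_leaf (a : S) k : width (Leaf a) k.+1 = 0.
Proof.
by rewrite /width (_ : [set u | _] = set0) ?cards0 //; apply/setP => -[[]] //= b u p; rewrite !inE.
Qed.

Lemma width_node (a : S) l r k :
  width (Node a l r) k.+1 = width l k + width r k.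
Proof.
rewrite /width.
pose L := [set u : k.-tuple bool | label l u : bool].
pose R := [set u : k.-tuple bool | label r u : bool].
pose c b (u : k.-tuple bool) := [tuple of b :: u].
have cI b : injective (c b) by move=> u v [] /val_inj.
have memc b (A : {set k.-tuple bool}) b' (u : k.-tuple bool) :
    ([tuple of b' :: u] \in c b @: A) = (b == b') && (u \in A).
  apply/imsetP/andP => [[v Av [-> /val_inj ->]]|[/eqP<- Au]]; first by rewrite eqxx.
  by exists u.
have -> : [set u : k.+1.-tuple bool | label (Node a l r) u : bool] = c false @: L :|: c true @: R.
  by apply/setP => u; case/tupleP: u => b u; rewrite in_setU !memc !inE; case: b; rewrite ?orbF.
rewrite -/L -/R -(card_imset L (cI false)) -(card_imset R (cI true)) -cardsUI.
rewrite [X in _ = _ + #|pred_of_set X|](_ : _ = set0) ?cards0 ?addn0 //.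
by apply/setP => u; case/tupleP: u => b u; rewrite in_setI !memc in_set0; case: b; rewrite ?andbF.
Qed.

Lemma width_gt0 t k : (0 < width t k) = (k <= height t).
Proof.
elim: t k => [a|a l IHl r IHr] [|k] /=; rewrite ?width0 ?width_leaf //.
by rewrite width_node addn_gt0 IHl IHr ltnS leq_max.
Qed.

Lemma width_exp t k : width t k <= 2 ^ k.
Proof. by apply: leq_trans (max_card _) _; rewrite card_tuple card_bool. Qed.

End Width.

(** * Pumping the height and the width of trees *)

Section Pumping.
Variables (S : finType) (M : tree_aut S).
Notation Q := (ta_state M).
Notation run := (@tree_run S M).
Implicit Types (t l r : tree S) (p q : Q).

Definition tall q := forall h, exists2 t, run t = q & h <= height t.
Definition wide q := forall w, exists2 t, run t = q & exists k, w <= width t k.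

(** In the generalisation, [X] stands for the states of the proper ancestors: any tree with state
    [run t] grows into a higher one with a given state of [X]. If [run t] were in [X], iteration
    would make it tall. So the states on a path are distinct, and the path has at most [#|Q|]
    nodes. *)
Lemma tall_height t : ~ tall (run t) -> height t < #|Q|.
Proof.
pose above p q := forall t, run t = q -> exists2 t', run t' = p & height t < height t'.
suff H (X : {set Q}) : (forall p, p \in X -> above p (run t)) ->
    ~ tall (run t) -> height t + #|X| < #|Q|.
  by move=> /(H set0); rewrite cards0 addn0; apply => p; rewrite inE.
have step (t0 : tree S) (Y : {set Q}) : (forall p, p \in Y -> above p (run t0)) ->
    ~ tall (run t0) -> run t0 \notin Y.
  move=> HY nt; apply/negP => /HY ab; apply: nt => h.
  elim: h => [|h [t1 E1 H1]]; first by exists t0.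
  by have [t2 E2 H2] := ab t1 E1; exists t2 => //; apply: leq_ltn_trans H2.
elim: t X => [a|a l IHl r IHr] X HX nt; have nX := step _ _ HX nt.
  by rewrite add0n; apply: leq_trans (max_card (mem (run (Leaf a) |: X))); rewrite cardsU1 nX.
have cX : #|run (Node a l r) |: X| = #|X|.+1 by rewrite cardsU1 nX.
(* A tree with the state of a child is completed to a higher one with the state of the node, so both
   hypotheses pass to the child. *)
have sub c (d : tree S) : (forall t', run t' = run c -> exists2 t'',
   run t'' = run (Node a l r) & height t' < height t'') ->
   (forall p, p \in run (Node a l r) |: X -> above p (run c)) /\ ~ tall (run c).
  move=> up; split=> [p|tc].
    rewrite in_setU1 => /orP[/eqP-> //|/HX ab] t' /up[t1 /ab[t2 E2 H2] H1].
    by exists t2 => //; apply: ltn_trans H2.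
  apply: nt => h; have [t' /up[t1 E1 H1] H] := tc h.
  by exists t1 => //; apply: leq_trans H (ltnW H1).
have [|Hl Tl] := sub l l.
  by move=> t' E; exists (Node a t' r); rewrite /= ?E // ltnS leq_maxl.
have [|Hr Tr] := sub r r.
  by move=> t' E; exists (Node a l t'); rewrite /= ?E // ltnS leq_maxr.
have := IHl _ Hl Tl; have := IHr _ Hr Tr; rewrite cX /= !addnS => A B.
by rewrite addSn; case: (leqP (height l) (height r)) => _.
Qed.

(* The maximal number on a path of nodes both of whose subtrees are high enough
   to be pumped. *)
Fixpoint heavy t : nat :=
  if t is Node _ l r then
    ((#|Q| <= height l) && (#|Q| <= height r)) + maxn (heavy l) (heavy r)
  else 0.

(** Up to level [#|Q|] the trivial bound [2 ^ k] suffices. Below that, a subtree of height less than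
    [#|Q|] contributes nothing, so the bound has to double only at nodes counted by [heavy]. *)
Lemma width_heavy t k : width t k <= 2 ^ (heavy t + #|Q|).
Proof.
elim: t k => [a|a l IHl r IHr] k.
  by case: k => [|k]; rewrite ?width0 ?width_leaf ?expn_gt0.
have [small|big] := leqP k #|Q|.
  by apply: leq_trans (width_exp _ _) _; rewrite leq_exp2l // (leq_trans small) // leq_addl.
case: k big => // k big; rewrite width_node /=.
have wl := leq_trans (IHl k) (leq_pexp2l (isT : 0 < 2)
  (leq_add (leq_maxl (heavy l) (heavy r)) (leqnn #|Q|))).
have wr := leq_trans (IHr k) (leq_pexp2l (isT : 0 < 2)
  (leq_add (leq_maxr (heavy l) (heavy r)) (leqnn #|Q|))).
case: andP => [_|/andP]; first by rewrite -addnA expnS mul2n -addnn leq_add.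
have low (d : tree S) : height d < k -> width d k = 0.
  by rewrite ltnNge -width_gt0 -eqn0Ngt => /eqP.
rewrite negb_and -!ltnNge add0n => /orP[] H.
  by rewrite (_ : width l k = 0) //; apply: low (leq_trans H _).
by rewrite addnC (_ : width r k = 0) //; apply: low (leq_trans H _).
Qed.

Fixpoint subtree_states t : seq Q :=
  run t :: (if t is Node _ l r then subtree_states l ++ subtree_states r else [::]).

(** In the generalisation, [X] stands for the states of the ancestors counted by [heavy]. At such a
    node the sibling of a child can be exchanged for a tree of the same state that reaches any given
    level. So a tree with the state of the child grows into a strictly wider one with the state of
    the node. A state repeated in this way would be wide, hence [X] gains an element at each such
    node. *)
Lemma heavy_leq t : (forall q, q \in subtree_states t -> ~ wide q) -> heavy t <= #|Q|.
Proof.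
pose above p q := forall t k, run t = q ->
  exists2 t', run t' = p & exists k', width t k < width t' k'.
suff H (X : {set Q}) : (forall p, p \in X -> above p (run t)) ->
    (forall q, q \in subtree_states t -> ~ wide q) -> heavy t + #|X| <= #|Q|.
  by move=> /(H set0); rewrite cards0 addn0; apply => p; rewrite inE.
have loop q : above q q -> (exists t, run t = q) -> wide q.
  move=> ab [t0 E0]; elim=> [|w [t1 E1 [k Hk]]]; first by exists t0 => //; exists 0.
  by have [t2 E2 [k' Hk']] := ab t1 k E1; exists t2 => //; exists k'; apply: leq_ltn_trans Hk'.
elim: t X => [a|a l IHl r IHr] X HX nw; first by rewrite add0n max_card.
pose wider c := forall t' k, run t' = run c ->
  exists2 t'', run t'' = run (Node a l r) & exists k', width t' k <= width t'' k'.
have up (c : tree S) (Y : {set Q}) : wider c ->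
   (forall p, p \in Y -> above p (run (Node a l r))) ->
   forall p, p \in Y -> above p (run c).
  move=> H HY p /HY ab t' k /(H t' k)[t1 /ab ab1 [k1 H1]].
  have [t2 E2 [k2 H2]] := ab1 k1.
  by exists t2 => //; exists k2; apply: leq_ltn_trans H2.
have upl : wider l.
  move=> t' k E; exists (Node a t' r); rewrite /= ?E //.
  by exists k.+1; rewrite width_node leq_addr.
have upr : wider r.
  move=> t' k E; exists (Node a l t'); rewrite /= ?E //.
  by exists k.+1; rewrite width_node leq_addl.
have nwl q : q \in subtree_states l -> ~ wide q.
  by move=> H; apply: nw; rewrite /= inE mem_cat H orbT.
have nwr q : q \in subtree_states r -> ~ wide q.
  by move=> H; apply: nw; rewrite /= inE mem_cat H !orbT.
rewrite /=; case: andP => [[hl hr]|_]; last first.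
  have Hl := IHl X (up _ _ upl HX) nwl; have Hr := IHr X (up _ _ upr HX) nwr.
  by rewrite add0n; case: (leqP (heavy l) (heavy r)) => _.
(* The goal is decidable and may be proved by refutation. Under the goal [False] the doubly negated
   tallness of both children becomes usable. *)
apply/negPn/negP => Nle.
have Tl : ~ ~ tall (run l) by move=> /tall_height; rewrite ltnNge hl.
have Tr : ~ ~ tall (run r) by move=> /tall_height; rewrite ltnNge hr.
apply: Tl => tl; apply: Tr => tr.
have abl : above (run (Node a l r)) (run l).
  (* The sibling is chosen after [k]: its height is at least [k], so it adds a node to the level in
     question. *)
  move=> t k E; have [r' E' H] := tr k; exists (Node a t r'); rewrite /= ?E ?E' //.
  by exists k.+1; rewrite width_node -[ltnLHS]addn0 ltn_add2l width_gt0.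
have abr : above (run (Node a l r)) (run r).
  move=> t k E; have [l' E' H] := tl k; exists (Node a l' t); rewrite /= ?E ?E' //.
  by exists k.+1; rewrite width_node -[ltnLHS]add0n ltn_add2r width_gt0.
have nX : run (Node a l r) \notin X.
  apply/negP => /HX ab; apply: (nw (run (Node a l r))); first by rewrite /= inE eqxx.
  by apply: loop => //; exists (Node a l r).
have HX' (c : tree S) : above (run (Node a l r)) (run c) -> wider c ->
   forall p, p \in run (Node a l r) |: X -> above p (run c).
  by move=> ab u p; rewrite in_setU1 => /orP[/eqP-> //|]; apply: up.
have cX : #|run (Node a l r) |: X| = #|X|.+1 by rewrite cardsU1 nX.
have := IHl _ (HX' l abl upl) nwl; have := IHr _ (HX' r abr upr) nwr.
rewrite cX !addnS => A B; case/negP: Nle.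
by rewrite add1n addSn; case: (leqP (heavy l) (heavy r)) => _.
Qed.

Lemma width_replace t q : q \in subtree_states t ->
  forall d, run d = q -> exists2 t', run t' = run t &
    forall k, exists k', width d k <= width t' k'.
Proof.
elim: t => [a|a l IHl r IHr] /=.
  by rewrite inE => /eqP-> d E; exists d => // k; exists k.
rewrite inE => /predU1P[-> d E|]; first by exists d => // k; exists k.
rewrite mem_cat => /orP[/IHl|/IHr] H d /H[t' E Hw].
  exists (Node a t' r); rewrite /= ?E // => k; have [k' H'] := Hw k.
  by exists k'.+1; rewrite width_node (leq_trans H') // leq_addr.
exists (Node a l t'); rewrite /= ?E // => k; have [k' H'] := Hw k.
by exists k'.+1; rewrite width_node (leq_trans H') // leq_addl.
Qed.

(** If a subtree of an accepted tree had a wide state, exchanging it for a wide enough tree would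
    keep acceptance and exceed the bound given by [slim]. The new bound depends only on the number
    of states, so it can be computed from the presentation. *)
Lemma slim_width (L : tree S -> Prop) : tree_recognizes M L -> slim L ->
  forall t, L t -> forall k, width t k <= 4 ^ #|Q|.
Proof.
move=> ML [K _ HK] t Lt k; apply: leq_trans (width_heavy _ _) _.
rewrite -[4]/(2 ^ 2) -expnM mul2n -addnn leq_exp2l // leq_add2r; apply: heavy_leq.
move=> q qt wq; have [d Ed [k' Hk']] := wq K.+1.
have [t' Et' /(_ k')[k2 Hk2]] := width_replace qt Ed.
have /HK : L t' by apply/ML; rewrite /tree_accepts Et'; apply/ML.
move=> /(leq_trans (width_thickness t' k2))/(leq_trans Hk2)/(leq_trans Hk').
by rewrite ltnn.
Qed.

End Pumping.

(** * Words of levels *)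

Fixpoint zipcat T (a b : seq (seq T)) : seq (seq T) :=
  match a, b with
  | [::], _ => b
  | _, [::] => a
  | x :: a', y :: b' => (x ++ y) :: zipcat a' b'
  end.

Lemma zipcats0 T (a : seq (seq T)) : zipcat a [::] = a.
Proof. by case: a. Qed.

Lemma zipcatA T : associative (@zipcat T).
Proof. by elim=> [|x a IH] [|y b] [|z c] //=; rewrite catA IH. Qed.

Lemma nth_zipcat T (a b : seq (seq T)) k :
  nth [::] (zipcat a b) k = nth [::] a k ++ nth [::] b k.
Proof.
elim: a b k => [|x a IH] [|y b] [|k] //=; rewrite ?nth_nil ?cats0 //.
Qed.

Section Levels.
Variable S : finType.
Implicit Types (t u : tree S) (ts us : seq (tree S)).

Definition tree_root t : S := match t with Leaf a => a | Node a _ _ => a end.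
Definition is_node t : bool := if t is Node _ _ _ then true else false.
Definition kids t := if t is Node _ l r then [:: l; r] else [::].

Definition root_entry t : nat * bool := (enum_rank (tree_root t) : nat, is_node t).

Fixpoint levels t : seq (seq (nat * bool)) :=
  [:: root_entry t] :: (if t is Node _ l r then zipcat (levels l) (levels r) else [::]).

Definition forest_levels ts := foldr (fun t => zipcat (levels t)) [::] ts.
Definition forest_kids ts := flatten (map kids ts).

Lemma size_levels t k : size (nth [::] (levels t) k) = width t k.
Proof.
elim: t k => [a|a l IHl r IHr] [|k] /=; rewrite ?width0 ?width_leaf //.
  by rewrite nth_nil.
by rewrite nth_zipcat size_cat IHl IHr width_node.
Qed.

Lemma forest_levels_cat ts us :
  forest_levels (ts ++ us) = zipcat (forest_levels ts) (forest_levels us).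
Proof. by elim: ts => //= t ts ->; rewrite zipcatA. Qed.

Lemma forest_kids_cat ts us : forest_kids (ts ++ us) = forest_kids ts ++ forest_kids us.
Proof. by rewrite /forest_kids map_cat flatten_cat. Qed.

Lemma forest_levels1 t : forest_levels [:: t] = levels t.
Proof. exact: zipcats0. Qed.

(** While [levels] recurses on subtrees, a word automaton reads level by level. This is the
    recursion along levels; it follows from the associativity of [zipcat]. *)
Lemma forest_levels_cons t ts : forest_levels (t :: ts) =
  map root_entry (t :: ts) :: forest_levels (forest_kids (t :: ts)).
Proof.
have Et u : levels u = [:: root_entry u] :: forest_levels (kids u).
  by case: u => //= a l r; rewrite zipcats0.
elim: ts t => [|u ts IH] t.
  by rewrite forest_levels1 Et /forest_kids /= cats0.
have -> : forest_levels [:: t, u & ts] = zipcat (levels t) (forest_levels (u :: ts)) by [].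
rewrite IH Et /=; congr (_ :: _).
by rewrite -forest_levels_cat.
Qed.

Lemma forest_levels_eq0 ts : nilp (forest_levels ts) = nilp ts.
Proof. by case: ts => // t ts; rewrite forest_levels_cons. Qed.

Lemma nth_forest_levels0 ts : nth [::] (forest_levels ts) 0 = map root_entry ts.
Proof. by case: ts => // t ts; rewrite forest_levels_cons. Qed.

Lemma behead_forest_levels ts :
  behead (forest_levels ts) = forest_levels (forest_kids ts).
Proof. by case: ts => // t ts; rewrite forest_levels_cons. Qed.

(** The bits in the root entries tell which trees own the next two children, so the flat list of
    children can be distributed again. *)
Lemma forest_kids_inj ts us :
  map root_entry ts = map root_entry us -> forest_kids ts = forest_kids us -> ts = us.
Proof.
elim: ts us => [|t ts IH] [|u us] //= [/ord_inj/enum_rank_inj Ea En Er].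
rewrite /forest_kids /=; case: t u Ea En => [a|a l r] [b|b l' r'] //= -> _.
  by move/IH => ->.
by move=> [-> -> /IH ->].
Qed.

Lemma forest_levels_inj : injective forest_levels.
Proof.
move=> ts us; have [n] := ubnP (size (forest_levels ts)).
elim: n ts us => // n IH [|t ts] us.
  by move=> _ /esym/nilP; rewrite forest_levels_eq0 => /nilP.
rewrite ltnS => ltn E; have := forest_levels_eq0 us; rewrite -E forest_levels_cons.
case: us E => // u us E _; apply: forest_kids_inj.
  by rewrite -!nth_forest_levels0 E.
apply: IH; last by rewrite -!behead_forest_levels E.
by move: ltn; rewrite forest_levels_cons.
Qed.

Lemma levels_inj : injective levels.
Proof.
by move=> t u E; have [] // : [:: t] = [:: u]; apply: forest_levels_inj; rewrite !forest_levels1.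
Qed.

Lemma levels_nonempty t : all (fun l => l != [::]) (levels t).
Proof.
elim: t => //= a l IHl r IHr.
elim: (levels l) (levels r) IHl IHr => [|x c IH] [|y d] //=.
by move=> /andP[x0 c0] /andP[_ d0]; rewrite IH // andbT; case: x x0.
Qed.

Lemma levels_ranks t : all (all (fun e => e.1 < #|S|)) (levels t).
Proof.
elim: t => [a|a l IHl r IHr] /=; rewrite ltn_ord //=.
elim: (levels l) (levels r) IHl IHr => [|x c IH] [|y d] //=.
by move=> /andP[x0 c0] /andP[y0 d0]; rewrite all_cat x0 y0 IH.
Qed.

End Levels.

(** * Convolutions of possibly absent trees *)

Section Convolution.
Variables (S L : finType) (xs : L -> seq (option S)).
Notation otree := (option (tree S)).

Definition oroot (o : otree) : option S := omap (@tree_root S) o.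
Definition onode (o : otree) : bool := oapp (@is_node S) false o.
Definition oleft (o : otree) : otree := if o is Some (Node _ l _) then Some l else None.
Definition oright (o : otree) : otree := if o is Some (Node _ _ r) then Some r else None.

(* Like [is_conv], but trees may be absent; this makes the notion hereditary. *)
Fixpoint convolves (os : seq otree) (s : tree L) : Prop :=
  match s with
  | Leaf x => [/\ xs x = map oroot os, has isSome os & ~~ has onode os]
  | Node x l r => [/\ xs x = map oroot os, has onode os,
      convolves (map oleft os) l & convolves (map oright os) r]
  end.

Lemma convolves_has os s : convolves os s -> has isSome os.
Proof.
by case: s => [x []|x l r [_ + _ _]] //; apply: sub_has; case.
Qed.

Lemma nth_omap T (f : otree -> option T) (os : seq otree) j :
  f None = None -> nth None (map f os) j = f (nth None os j).
Proof.
move=> f0; have [lt|ge] := ltnP j (size os); first by rewrite (nth_map None).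
by rewrite !nth_default ?size_map.
Qed.

End Convolution.

(** * The nondeterministic automaton on frontiers *)

Section Step.
Variables (n : nat) (init : seq (option nat) -> nat).
Variable delta : seq (option nat) -> nat -> nat -> nat.

Implicit Types (m : seq bool) (ys : seq (seq (nat * bool))).

(* A frontier lists the nodes of one level of a convolution, each with the set
   of components having this node and the state of an automaton at the node. *)
Definition frontier := seq (seq bool * nat).

Definition entry m ys j := if nth false m j then ohead (nth [::] ys j) else None.
Definition letter m ys := [seq omap (fun e => e.1) (entry m ys j) | j <- iota 0 n].
Definition node_bits m ys := [seq oapp (fun e => e.2) false (entry m ys j) | j <- iota 0 n].
Definition rest m ys :=
  [seq if nth false m j then behead (nth [::] ys j) else nth [::] ys j | j <- iota 0 n].

(* Consumes the entries of one frontier node from the levels [a.1] of the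
   components, and its children, if any, from the next frontier [a.2]. *)
Definition consume (a : option (seq (seq (nat * bool)) * frontier)) (e : seq bool * nat) :=
  oapp (fun a : seq (seq (nat * bool)) * frontier =>
    if (map isSome (letter e.1 a.1) == e.1) && has id e.1 then
      if has id (node_bits e.1 a.1) then
        oapp (fun e1 => oapp (fun e2 : seq bool * nat =>
          if (e1.1 == node_bits e.1 a.1) && ((e2.1 == node_bits e.1 a.1) &&
              (e.2 == delta (letter e.1 a.1) e1.2 e2.2))
          then Some (rest e.1 a.1, behead (behead a.2)) else None)
          None (ohead (behead a.2))) None (ohead a.2)
      else if e.2 == init (letter e.1 a.1) then Some (rest e.1 a.1, a.2) else None
    else None) None a.

(** Both the levels and the next frontier must be used up exactly. The empty frontier has no
    successor, so no letter may follow the last level. *)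
Definition trans (z : frontier) ys (z' : frontier) : bool :=
  ~~ nilp z && oapp (fun r => all (fun l => nilp l) r.1 && nilp r.2) false
    (foldl consume (Some (ys, z')) z).

Variable Z : seq frontier.

Fixpoint accepts_from (z : frontier) (w : seq (seq (seq (nat * bool)))) : bool :=
  if w is ys :: w' then has (fun z' => trans z ys z' && accepts_from z' w') Z
  else nilp z.

Definition powerstep (X : seq frontier) ys :=
  [seq z' <- Z | has (fun z => trans z ys z') X].

(** The invariant of the subset construction: only the empty frontier accepts the empty word, so a
    set is final when it contains it. *)
Lemma powerstep_accepts w X :
  ([::] \in foldl powerstep X w) = has (accepts_from^~ w) X.
Proof.
elim: w X => [|ys w IH] X /=; first by rewrite -has_pred1; apply: eq_has => z; case: z.
rewrite IH; apply/hasP/hasP => [[z' + az']|[z zX /hasP[z' z'Z /andP[tr az']]]].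
  rewrite mem_filter => /andP[/hasP[z zX tr] z'Z]; exists z => //.
  by apply/hasP; exists z' => //; rewrite tr.
by exists z' => //; rewrite mem_filter z'Z andbT; apply/hasP; exists z.
Qed.

Lemma foldl_consume_None z : foldl consume None z = None.
Proof. by elim: z. Qed.

End Step.

(* [init_n] and [delta_n] represent [M] on ranks.  The letters of [M] are viewed
   through [xs] as tuples of padded letters, so that the automaton for the domain
   is treated as one for a unary relation. *)
Section Forests.
Variables (S L : finType) (n : nat) (xs : L -> seq (option S)) (M : tree_aut L).
Variables (init_n : seq (option nat) -> nat) (delta_n : seq (option nat) -> nat -> nat -> nat).

Definition rank (T : finType) (x : T) : nat := enum_rank x.
Notation ranks := (map (omap (@rank S))).

Hypothesis size_xs : forall l, size (xs l) = n.
Hypothesis xs_surj : forall x, size x = n -> has isSome x -> exists l, xs l = x.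
Hypothesis init_nE : forall l, init_n (ranks (xs l)) = rank (ta_init M l).
Hypothesis delta_nE : forall l (p q : ta_state M),
  delta_n (ranks (xs l)) (rank p) (rank q) = rank (ta_delta l p q).

(** A node of a convolution is represented by what lies below it: the subtree of the convolution and
    those of the components. Lists of such nodes are the objects that frontiers describe. *)
Definition node := (tree L * seq (option (tree S)))%type.
Implicit Types (e : node) (phi : seq node).

Definition valid e : Prop := convolves xs e.2 e.1.
Fixpoint valids phi : Prop := if phi is e :: phi' then valid e /\ valids phi' else True.

Definition node_kids e : seq node :=
  if e.1 is Node _ l r then [:: (l, map (@oleft S) e.2); (r, map (@oright S) e.2)] else [::].
Definition nodes_kids phi := flatten (map node_kids phi).
Definition component j phi : seq (tree S) := pmap (fun e => nth None e.2 j) phi.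
Definition node_frontier e : seq bool * nat := (map isSome e.2, rank (tree_run M e.1)).

Lemma valid_size e : valid e -> size e.2 = n.
Proof.
rewrite /valid; case: e => -[x|x l r] os /= [E]; rewrite -(size_map (@oroot S)) -E size_xs //.
Qed.

Lemma valids_cat phi psi : valids (phi ++ psi) <-> valids phi /\ valids psi.
Proof. by elim: phi => //= [|e phi IH]; tauto. Qed.

Lemma valids_kids phi : valids phi -> valids (nodes_kids phi).
Proof.
elim: phi => //= e phi IH [Ve /IH Vp]; apply/valids_cat; split=> //.
by move: Ve; case: e => -[x|x l r] os //= [_ _ Vl Vr].
Qed.

Lemma nth_left os j : nth None (map (@oleft S) os) j = oleft (nth None os j).
Proof. exact: nth_omap. Qed.
Lemma nth_right os j : nth None (map (@oright S) os) j = oright (nth None os j).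
Proof. exact: nth_omap. Qed.

Lemma component_cons j e phi :
  component j (e :: phi) = seq_of_opt (nth None e.2 j) ++ component j phi.
Proof. by rewrite /component /=; case: (nth None e.2 j). Qed.

Lemma component_cat j phi psi :
  component j (phi ++ psi) = component j phi ++ component j psi.
Proof. exact: pmap_cat. Qed.

(** At a leaf of the convolution no component branches. At an inner node a component that is absent
    or a leaf yields no children on either side. *)
Lemma component_kids j phi : valids phi ->
  component j (nodes_kids phi) = forest_kids (component j phi).
Proof.
elim: phi => [//|e phi IH] [Ve /IH {}IH].
rewrite component_cons forest_kids_cat -IH.
rewrite -[nodes_kids (e :: phi)]/(node_kids e ++ nodes_kids phi) component_cat; congr (_ ++ _).
case: e Ve => -[x|x l r] os /= [_].
  move=> _ /negP no; case Ej: (nth None os j) => [[//|a t u]|//].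
  case: no; apply/(has_nthP None); exists j; rewrite ?Ej //=.
  by rewrite ltnNge; apply/negP => /(nth_default None); rewrite Ej.
by rewrite /component /= nth_left nth_right; case: (nth None os j) => [[]|].
Qed.

(** The unread levels while [consume] passes through a forest: the entries of [phi] come next, and
    [ws] is what remains after them. *)
Definition roots phi (ws : seq (seq (nat * bool))) :=
  [seq map (@root_entry S) (component j phi) ++ nth [::] ws j | j <- iota 0 n].

Lemma map_iota_nth (T : Type) (x0 : T) s : size s = n -> [seq nth x0 s j | j <- iota 0 n] = s.
Proof. by move=> <-; exact: mkseq_nth. Qed.

Lemma nth_map_iota (T : Type) (x0 : T) f j : j < n -> nth x0 [seq f k | k <- iota 0 n] j = f j.
Proof. by move=> lt; rewrite (nth_map 0) ?size_iota // nth_iota. Qed.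

Lemma letter_roots e phi ws : valid e -> 
  letter n (map isSome e.2) (roots (e :: phi) ws) = ranks (map (@oroot S) e.2).
Proof.
move=> /valid_size Es; rewrite -map_comp -[in RHS](map_iota_nth None Es) -map_comp.
apply/eq_in_map => j; rewrite mem_iota /= add0n => lt.
rewrite /entry (nth_map None) ?Es // /roots nth_map_iota // component_cons.
by case: (nth None e.2 j).
Qed.

Lemma bits_roots e phi ws : valid e ->
  node_bits n (map isSome e.2) (roots (e :: phi) ws) = map (@onode S) e.2.
Proof.
move=> /valid_size Es; rewrite -[in RHS](map_iota_nth None Es) -map_comp.
apply/eq_in_map => j; rewrite mem_iota /= add0n => lt.
rewrite /entry (nth_map None) ?Es // /roots nth_map_iota // component_cons.
by case: (nth None e.2 j).
Qed.

Lemma rest_roots e phi ws : valid e ->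
  rest n (map isSome e.2) (roots (e :: phi) ws) = roots phi ws.
Proof.
move=> /valid_size Es; apply/eq_in_map => j; rewrite mem_iota /= add0n => lt.
rewrite (nth_map None) ?Es // /roots nth_map_iota // component_cons.
by case: (nth None e.2 j).
Qed.

Lemma consume_node e phi ws z : valid e ->
  consume n init_n delta_n
    (Some (roots (e :: phi) ws, map node_frontier (node_kids e) ++ z)) (node_frontier e)
  = Some (roots phi ws, z).
Proof.
move=> Ve; rewrite /consume /= letter_roots // bits_roots // rest_roots //.
rewrite -!map_comp (eq_map (g := isSome)); last by case.
rewrite eqxx has_map (eq_has (a2 := isSome)) // (convolves_has Ve) /=.
rewrite has_map (eq_has (a2 := @onode S)) // /node_frontier.
case: e Ve => -[x|x l r] os /=.
  by case=> Ex _ /negPf->; rewrite map_comp -Ex init_nE eqxx.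
case=> Ex -> _ _ /=.
have El : map isSome (map (@oleft S) os) = map (@onode S) os.
  by rewrite -map_comp; apply: eq_map => -[[]|].
have Er : map isSome (map (@oright S) os) = map (@onode S) os.
  by rewrite -map_comp; apply: eq_map => -[[]|].
by rewrite El Er map_comp -Ex delta_nE !eqxx.
Qed.

Lemma foldl_consume phi ws z : valids phi -> size ws = n ->
  foldl (consume n init_n delta_n)
    (Some (roots phi ws, map node_frontier (nodes_kids phi) ++ z)) (map node_frontier phi)
  = Some (ws, z).
Proof.
move=> Vp sw; elim: phi Vp => [_|e phi IH [Ve Vp]].
  by rewrite /roots /= map_iota_nth.
by rewrite -IH // -(consume_node phi ws _ Ve) catA -map_cat.
Qed.

(** Completeness of a step: the actual children with their actual states are a successful guess. *)
Lemma trans_complete phi : valids phi -> ~~ nilp phi ->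
  trans n init_n delta_n (map node_frontier phi)
    [seq map (@root_entry S) (component j phi) | j <- iota 0 n]
    (map node_frontier (nodes_kids phi)).
Proof.
move=> Vp p0; rewrite /trans /nilp size_map -/(nilp phi) p0 /=.
have -> : [seq map (@root_entry S) (component j phi) | j <- iota 0 n] = roots phi (nseq n [::]).
  by apply: eq_map => j; rewrite nth_nseq if_same cats0.
rewrite -(cats0 (map node_frontier (nodes_kids phi))) foldl_consume ?size_nseq //=.
by rewrite all_nseq orbT.
Qed.

Lemma ranks_surj (x : seq (option nat)) :
  all (fun o => oapp (fun a => a < #|S|) true o) x -> exists x0, ranks x0 = x.
Proof.
elim: x => [_|o x IH /= /andP[lt /IH[x0 E]]]; first by exists [::].
case: o lt => [a|] lt; last by exists (None :: x0); rewrite /= E.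
by exists (Some (enum_val (Ordinal lt)) :: x0); rewrite /= E /rank enum_valK.
Qed.

Lemma nth_omap_rank (x0 : seq (option S)) j :
  nth None (ranks x0) j = omap (@rank S) (nth None x0 j).
Proof.
by have [lt|ge] := ltnP j (size x0); [rewrite (nth_map None) | rewrite !nth_default ?size_map].
Qed.

(** Undoes one [consume]: the entries removed for [e] are put back in front of those of the
    remaining nodes. *)
Lemma roots_cons e phi ys m : size ys = n -> m = map isSome e.2 ->
  (forall j, j < n -> omap (@root_entry S) (nth None e.2 j) = entry m ys j) ->
  rest n m ys = [seq map (@root_entry S) (component j phi) | j <- iota 0 n] ->
  ys = [seq map (@root_entry S) (component j (e :: phi)) | j <- iota 0 n].
Proof.
move=> sy -> He Hr; apply: (@eq_from_nth _ [::]); first by rewrite size_map size_iota.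
move=> j; rewrite sy => lt; rewrite nth_map_iota // component_cons.
have := congr1 (fun r => nth [::] r j) Hr; rewrite !nth_map_iota // map_cat => <-.
have := He j lt; rewrite /entry.
have -> : nth false (map isSome e.2) j = isSome (nth None e.2 j).
  by have [ltj|ge] := ltnP j (size e.2); [rewrite (nth_map None) | rewrite !nth_default ?size_map].
by case: (nth None e.2 j) => [t|] //=; case: (nth [::] ys j) => //= y r [->].
Qed.

(** Soundness of a step. A forest [phi'] realising the next frontier is given, and each node of [z]
    becomes a leaf or takes the next two nodes of [phi'] as its children. *)
Lemma trans_sound z ys phi' : size ys = n ->
  (forall j, all (fun a => a.1 < #|S|) (nth [::] ys j)) -> valids phi' ->
  oapp (fun r => all (fun l => nilp l) r.1 && nilp r.2) false
    (foldl (consume n init_n delta_n) (Some (ys, map node_frontier phi')) z) ->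
  exists phi, [/\ valids phi, map node_frontier phi = z, nodes_kids phi = phi' &
    ys = [seq map (@root_entry S) (component j phi) | j <- iota 0 n]].
Proof.
elim: z ys phi' => [|[m q] z IH] ys phi' sy lab Vp /=.
  case: phi' Vp => [_|e phi' _] /=; rewrite ?andbF // andbT => /allP ny; exists [::]; split=> //.
  apply: (@eq_from_nth _ [::]); first by rewrite size_map size_iota.
  move=> j lt; rewrite nth_map_iota -?sy //; apply/nilP.
  by apply: ny; rewrite mem_nth.
rewrite /consume /=; case: ifP => [/andP[/eqP Em hm]|_]; last by rewrite foldl_consume_None.
have [x0 Ex] : exists x0, ranks x0 = letter n m ys.
  apply: ranks_surj; apply/allP => o /mapP[j _ ->]; rewrite /entry.
  by case: ifP => // _; have := lab j; case: (nth [::] ys j) => //= y r /andP[].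
have sx : size x0 = n by rewrite -(size_map (omap (@rank S))) Ex size_map size_iota.
have Em' : m = map isSome x0.
  by rewrite -Em -Ex -map_comp; apply: eq_map; case.
have [l El] : exists l, xs l = x0.
  by apply: xs_surj => //; move: hm; rewrite Em' has_map; apply: sub_has.
have lab' j : all (fun a => a.1 < #|S|) (nth [::] (rest n m ys) j).
  have [lt|ge] := ltnP j n; last by rewrite nth_default ?size_map ?size_iota.
  rewrite nth_map_iota //; case: ifP => // _.
  by have := lab j; case: (nth [::] ys j) => //= y r /andP[].
have sr : size (rest n m ys) = n by rewrite size_map size_iota.
have xE j : j < n -> omap (@rank S) (nth None x0 j) = omap (fun a => a.1) (entry m ys j).
  by move=> lt; rewrite -nth_omap_rank Ex nth_map_iota.
case: ifPn => [hb|nb]; last first.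
  case: eqP => [Eq|_]; last by rewrite foldl_consume_None.
  case/(IH _ _ sr lab' Vp) => phi [V1 E1 E2 E3].
  (* No branching bit is set here, so every component that is present is a leaf. *)
  pose os := map (omap (@Leaf S)) x0.
  have os_root : map (@oroot S) os = x0.
    by rewrite -map_comp -[RHS]map_id; apply: eq_map; case.
  have os_some : map isSome os = m by rewrite -map_comp Em'; apply: eq_map; case.
  exists ((Leaf l, os) :: phi); split.
  - split=> //; split=> /=; rewrite ?os_root //.
      by move: hm; rewrite -os_some has_map.
    by rewrite has_map -all_predC; elim: (x0) => //= -[].
  - by rewrite /= E1 /node_frontier /= os_some Eq -Ex -El init_nE.
  - by rewrite -E2.
  - apply: (roots_cons (m := m)) => //= j lt.
    have -> : nth None os j = omap (@Leaf S) (nth None x0 j).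
      by rewrite (nth_map None) ?sx.
    have := xE j lt; case: (nth None x0 j) => [a|]; case E: (entry m ys j) => [[c b]|] //= [<-].
    suff /negbTE -> : ~~ b by [].
    by apply: (hasPn nb); apply/mapP; exists j; rewrite ?mem_iota // E.
case: phi' Vp => [|e1 [|e2 phi']] /=; rewrite ?foldl_consume_None // => -[V1 [V2 Vp]].
case: ifP => [/and3P[/eqP b1 /eqP b2 /eqP Eq]|_]; last by rewrite foldl_consume_None.
case/(IH _ _ sr lab' Vp) => phi [Vphi E1 E2 E3].
(* By [b1] and [b2] the masks of both children equal the branching bits. So in each component either
   both children are present or neither is, and the second case of [mk] is that of a leaf. *)
pose mk (a : option S) (u v : option (tree S)) := match a, u, v with
  | Some a, Some u, Some v => Some (Node a u v)
  | Some a, _, _ => Some (Leaf a)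
  | None, _, _ => None
  end.
pose os := [seq mk (nth None x0 j) (nth None e1.2 j) (nth None e2.2 j) | j <- iota 0 n].
have nth_os j : j < n -> nth None os j = mk (nth None x0 j) (nth None e1.2 j) (nth None e2.2 j).
  by move=> lt; rewrite nth_map_iota.
have bE e j : valid e -> map isSome e.2 = node_bits n m ys -> j < n ->
    isSome (nth None e.2 j) = oapp (fun a => a.2) false (entry m ys j).
  move=> /valid_size se Eb lt; have := congr1 (fun r => nth false r j) Eb.
  by rewrite (nth_map None) ?se // nth_map_iota.
have os_l : map (@oleft S) os = e1.2.
  apply: (@eq_from_nth _ None); rewrite !size_map size_iota ?(valid_size V1) // => j lt.
  rewrite nth_left nth_os //.
  have := xE j lt; have := bE _ _ V1 b1 lt; have := bE _ _ V2 b2 lt.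
  by case: (entry m ys j) => [[c []]|]; case: (nth None e1.2 j);
     case: (nth None e2.2 j); case: (nth None x0 j).
have os_r : map (@oright S) os = e2.2.
  apply: (@eq_from_nth _ None); rewrite !size_map size_iota ?(valid_size V2) // => j lt.
  rewrite nth_right nth_os //.
  have := xE j lt; have := bE _ _ V1 b1 lt; have := bE _ _ V2 b2 lt.
  by case: (entry m ys j) => [[c []]|]; case: (nth None e1.2 j);
     case: (nth None e2.2 j); case: (nth None x0 j).
have os_root : map (@oroot S) os = x0.
  rewrite -[RHS](map_iota_nth None sx) -map_comp; apply: eq_map => j /=.
  by case: (nth None x0 j) => // a; case: (nth None e1.2 j) => // u; case: (nth None e2.2 j).
have os_some : map isSome os = m.
  by rewrite Em' -os_root -map_comp; apply: eq_map; case.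
have os_node : map (@onode S) os = node_bits n m ys.
  by rewrite -b1 -os_l -map_comp; apply: eq_map => -[[]|].
exists ((Node l e1.1 e2.1, os) :: phi); split.
- split=> //; split=> /=; rewrite ?os_root ?os_l ?os_r //.
  by move: hb; rewrite -os_node has_map.
- by rewrite /= E1 /node_frontier /= os_some Eq -Ex -El delta_nE.
- by rewrite -E2 /nodes_kids /= os_l os_r; case: (e1) => ? ?; case: (e2).
- apply: (roots_cons (m := m)) => //= j lt; rewrite nth_os //.
  have := xE j lt; have := bE _ _ V1 b1 lt; have := bE _ _ V2 b2 lt.
  by case: (entry m ys j) => [[c []]|]; case: (nth None e1.2 j) => [?|];
     case: (nth None e2.2 j) => [?|]; case: (nth None x0 j) => [?|] //= _ _ [<-].
Qed.

(** The default [[::]] of [nth] acts as padding; the condition on the size excludes trailing letters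
    that consist of padding only. *)
Definition matches (w : seq (seq (seq (nat * bool)))) phi : Prop :=
  size w = \max_(j < n) size (forest_levels (component j phi)) /\
  forall j, j < n -> forall k,
    nth [::] (nth [::] w k) j = nth [::] (forest_levels (component j phi)) k.

Lemma component_eq0 phi : valids phi ->
  (forall j, j < n -> nilp (component j phi)) -> phi = [::].
Proof.
case: phi => // e phi [Ve _] H.
have /(has_nthP None)[j lt] := convolves_has Ve.
rewrite (valid_size Ve) in lt.
by have := H j lt; rewrite component_cons; case: (nth None e.2 j).
Qed.

Lemma matches_nil phi : valids phi -> matches [::] phi -> phi = [::].
Proof.
move=> Vp [sz _]; apply: component_eq0 => // j lt.
rewrite -forest_levels_eq0 /nilp -leqn0 [leqRHS]sz.
exact: (@leq_bigmax _ (fun j : 'I_n => size (forest_levels (component j phi))) (Ordinal lt)).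
Qed.

Lemma matches0 : matches [::] [::].
Proof.
split; first by rewrite big1.
by move=> j _ k; rewrite !nth_nil.
Qed.

Lemma size_kids_levels phi : valids phi ->
  \max_(j < n) size (forest_levels (component j (nodes_kids phi))) =
  (\max_(j < n) size (forest_levels (component j phi))).-1.
Proof.
move=> Vp; rewrite (big_morph predn (id1 := 0) (op1 := maxn)) //; last first.
  by case=> [|a] [|b]; rewrite ?maxnSS ?max0n ?maxn0.
by apply: eq_bigr => j _; rewrite component_kids // -behead_forest_levels size_behead.
Qed.

Lemma matches_cons ys w phi : valids phi ->
  matches (ys :: w) phi <->
  [/\ ~~ nilp phi, forall j, j < n -> nth [::] ys j = map (@root_entry S) (component j phi)
    & matches w (nodes_kids phi)].
Proof.
move=> Vp; split=> [[/= sz H]|[p0 Hys [sz H]]].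
  split=> [|j lt|]; first by case: (phi) sz => // sz; rewrite big1 in sz.
    by rewrite -nth_forest_levels0 -H.
  split=> [|j lt k]; first by rewrite size_kids_levels // -sz.
  by rewrite component_kids // -behead_forest_levels nth_behead -H.
split=> [|j lt [|k]] /=.
- rewrite sz size_kids_levels // prednK // lt0n; apply: contra p0 => /eqP M0.
  have -> // : phi = [::]; apply: component_eq0 => // j lt.
  rewrite -forest_levels_eq0 /nilp -leqn0 -[leqRHS]M0.
  exact: (@leq_bigmax _ (fun j : 'I_n => size (forest_levels (component j phi))) (Ordinal lt)).
- by rewrite nth_forest_levels0 Hys.
- by rewrite H // component_kids // -behead_forest_levels nth_behead.
Qed.

(** Every node of a convolution lies in some component. This is the source of the bound [n * K] on
    the length of frontiers. *)
Lemma size_components phi : valids phi ->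
  size phi <= \sum_(j < n) size (component j phi).
Proof.
elim: phi => //= e phi IH [Ve /IH {}IH].
have -> : \sum_(j < n) size (component j (e :: phi)) =
   \sum_(j < n) (nth None e.2 j : bool) + \sum_(j < n) size (component j phi).
  rewrite -big_split; apply: eq_bigr => j _; rewrite component_cons size_cat.
  by case: (nth None e.2 j).
rewrite -add1n leq_add //.
have /(has_nthP None)[j lt] := convolves_has Ve.
rewrite (valid_size Ve) in lt => oj.
by rewrite (bigD1 (Ordinal lt)) //= oj.
Qed.

Variables (Z : seq frontier) (K : nat).
Hypothesis mem_Z : forall z, (z \in Z) =
  (size z <= n * K) && all (fun a => (size a.1 == n) && (a.2 < #|ta_state M|)) z.

Lemma node_frontier_Z phi : valids phi -> 
  (forall j, j < n -> size (component j phi) <= K) -> map node_frontier phi \in Z.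
Proof.
move=> Vp Hs; rewrite mem_Z size_map; apply/andP; split.
  apply: leq_trans (size_components Vp) _.
  rewrite -[n in n * K]card_ord -sum_nat_const; apply: leq_sum => j _; exact: Hs.
elim: phi Vp {Hs} => //= e phi IH [Ve /IH ->].
by rewrite size_map (valid_size Ve) eqxx ltn_ord.
Qed.

Lemma accepts_from_complete w phi : valids phi -> matches w phi ->
  all (fun ys => (size ys == n) && all (fun l => size l <= K) ys) w ->
  accepts_from n init_n delta_n Z (map node_frontier phi) w.
Proof.
elim: w phi => [|ys w IH] phi Vp; first by move=> /(matches_nil Vp) ->.
move=> /(matches_cons _ _ Vp)[p0 Hys Hw] /= /andP[/andP[/eqP sy _] bw].
have Vk := valids_kids Vp.
apply/hasP; exists (map node_frontier (nodes_kids phi)).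
  apply: node_frontier_Z => // j lt.
  (* The guessed frontier is bounded through the next letter, whose levels have at most [K] entries.
     If there is no next letter, the frontier is empty. *)
  rewrite -(size_map (@root_entry S)); case: w Hw bw {IH} => [|ys' w] Hw bw.
    by rewrite (matches_nil Vk Hw).
  have /(matches_cons _ _ Vk)[_ <- // _] := Hw.
  move: bw => /= /andP[/andP[/eqP sy' /allP bw] _].
  by apply: bw; rewrite mem_nth ?sy'.
rewrite IH // andbT.
have -> : ys = [seq map (@root_entry S) (component j phi) | j <- iota 0 n].
  apply: (@eq_from_nth _ [::]); first by rewrite size_map size_iota.
  by move=> j; rewrite sy => lt; rewrite Hys // nth_map_iota.
exact: trans_complete.
Qed.

(** The forest is built from the end of the word: the induction hypothesis realises the guessed
    frontier, and [trans_sound] adds one level on top. *)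
Lemma accepts_from_sound w z :
  all (fun ys => (size ys == n) && all (all (fun a => a.1 < #|S|)) ys) w ->
  accepts_from n init_n delta_n Z z w ->
  exists phi, [/\ valids phi, map node_frontier phi = z & matches w phi].
Proof.
elim: w z => [|ys w IH] z /=; first by move=> _ /nilP ->; exists [::]; split=> //; apply: matches0.
move=> /andP[/andP[/eqP sy /allP lab] bw] /hasP[z' _ /andP[/andP[z0 tr] /(IH _ bw)]].
move=> [phi' [Vp' E' Hw]]; rewrite -E' in tr.
have [//|j||phi [Vp Ez Ek Eys]] := @trans_sound z ys phi' _ _ _ tr => //.
  have [lt|ge] := ltnP j (size ys); last by rewrite nth_default.
  by apply: lab; rewrite mem_nth.
exists phi; split=> //; apply/matches_cons => //; split; last by rewrite Ek.
  by move: z0; rewrite -Ez /nilp size_map.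
by move=> j lt; rewrite Eys nth_map_iota.
Qed.

End Forests.

(** * The powerset automaton *)

Section Enumerations.
Variable T : eqType.
Implicit Types (s l : seq T) (n : nat).

Definition cons_all s (r : seq (seq T)) := [seq x :: l | x <- s, l <- r].
Definition words s n : seq (seq T) := iter n (cons_all s) [:: [::]].
Definition words_upto s n : seq (seq T) :=
  iter n (fun r => [::] :: cons_all s r) [:: [::]].
Definition subseqs s : seq (seq T) :=
  foldr (fun x r => [seq x :: l | l <- r] ++ r) [:: [::]] s.

Lemma mem_cons_all s r x l : (x :: l \in cons_all s r) = (x \in s) && (l \in r).
Proof.
apply/allpairsP/andP => [[[y k] /= [ys kr [-> ->]]]|[xs lr]]; first by [].
by exists (x, l).
Qed.

Lemma nil_cons_all s r : [::] \notin cons_all s r.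
Proof. by apply/allpairsP => -[[y k] /= []]. Qed.

Lemma uniq_cons_all s r : uniq s -> uniq r -> uniq (cons_all s r).
Proof. by move=> Us Ur; apply: allpairs_uniq => // -[x l] [y k] _ _ /= [-> ->]. Qed.

Lemma mem_words s n l : (l \in words s n) = (size l == n) && all (mem s) l.
Proof.
elim: n l => [|n IH] [|x l] //=; first by rewrite (negbTE (nil_cons_all _ _)).
by rewrite mem_cons_all IH eqSS andbCA.
Qed.

Lemma mem_words_upto s n l : (l \in words_upto s n) = (size l <= n) && all (mem s) l.
Proof.
elim: n l => [|n IH] [|x l] //=; rewrite in_cons //.
by rewrite mem_cons_all IH ltnS andbCA.
Qed.

Lemma words_upto_behead s n : words_upto s n = [::] :: behead (words_upto s n).
Proof. by case: n. Qed.

Lemma uniq_words_upto s n : uniq s -> uniq (words_upto s n).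
Proof.
move=> Us; elim: n => //= n IH; rewrite nil_cons_all; exact: uniq_cons_all.
Qed.

(** Every set of frontiers reached by the powerset automaton is a filter of one fixed list, hence a
    member of its list of states. *)
Lemma filter_subseqs (P : pred T) s : filter P s \in subseqs s.
Proof.
elim: s => //= x s IH; rewrite mem_cat; case: (P x); last by rewrite IH orbT.
by apply/orP; left; apply: map_f.
Qed.

Lemma size_subseqs_gt0 s : 0 < size (subseqs s).
Proof. by elim: s => //= x s IH; rewrite size_cat addn_gt0 IH orbT. Qed.

End Enumerations.

(* [enc] maps these to the codes of automata given by [code_tree_aut] and
   [code_word_aut]; the units stand for the ends of the rows of the tables. *)
Definition tree_tables (T : Type) : Type :=
  nat * (seq (T * nat) * (seq (T * (nat * (nat * (nat * unit)))) * seq nat)).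
Definition word_tables (T : Type) : Type :=
  nat * (nat * (seq (nat * (T * (nat * unit))) * seq nat)).

Definition lookup (T : eqType) (x : T) (s : seq (T * nat)) : nat :=
  foldr (fun r acc => if r.1 == x then r.2 else acc) 0 s.

Lemma lookupP (T : eqType) (x : T) (s : seq (T * nat)) v :
  (x, v) \in s -> (forall r, r \in s -> r.1 = x -> r.2 = v) -> lookup x s = v.
Proof.
elim: s => //= r s IH; rewrite inE => xs H.
case: eqP => [Er|ne]; first by apply: H Er; rewrite mem_head.
apply: IH => [|r' r's]; last by apply: H; rewrite inE r's orbT.
by case/orP: xs ne => // /eqP <-.
Qed.

Section Powerset.
Notation word := (seq (option nat)).
Variables (n K : nat) (A : tree_tables word).

Definition init_table (x : word) : nat := lookup x A.2.1.
Definition delta_table (x : word) (p q : nat) : nat :=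
  lookup (x, (p, q)) [seq ((r.1, (r.2.1, r.2.2.1)), r.2.2.2.1) | r <- A.2.2.1].

Definition frontiers : seq frontier :=
  words_upto [seq (m, q) | m <- words [:: false; true] n, q <- iota 0 A.1] (n * K).

Lemma mem_frontiers z : (z \in frontiers) =
  (size z <= n * K) && all (fun a => (size a.1 == n) && (a.2 < A.1)) z.
Proof.
rewrite mem_words_upto; congr (_ && _); apply: eq_all => -[m q] /=.
have bm : all (mem [:: false; true]) m by apply/allP => -[].
apply/allpairsP/andP => [[[m' q'] /= []]|[/eqP sm lt]].
  by rewrite mem_words mem_iota => /andP[/eqP sm _] lt [-> ->]; rewrite sm.
by exists (m, q); rewrite /= mem_words sm eqxx bm mem_iota.
Qed.

Definition power_states := subseqs frontiers.
(** A filter of [frontiers], so that it is one of [power_states]. The root belongs to all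
    components, and its guessed state has to be final. *)
Definition power_init : seq frontier :=
  [seq z <- frontiers | z \in [seq [:: (nseq n true, q)] | q <- A.2.2.2]].
Definition power_delta (X : seq frontier) ys : seq frontier :=
  powerstep n init_table delta_table frontiers X ys.

Definition power_tables (T : Type) (ls : seq (T * seq (seq (nat * bool)))) :
    word_tables T :=
  (size power_states, (index power_init power_states,
   ([seq (p, (a.1, (index (power_delta (nth [::] power_states p) a.2) power_states, tt)))
    | p <- iota 0 (size power_states), a <- ls],
    [seq p <- iota 0 (size power_states) | [::] \in nth [::] power_states p]))).

Variables (G : finType) (ys : G -> seq (seq (nat * bool))).

(** States are positions in [power_states], which makes their ranks and thus the code of the
    automaton explicit. The form [.-1.+1] is the one that [inord] works with. *)
Definition power_aut : word_aut G :=
  @WordAut G 'I_(size power_states).-1.+1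
    (inord (index power_init power_states))
    (fun p a => inord (index (power_delta (nth [::] power_states p) (ys a)) power_states))
    [set p : 'I__ | [::] \in nth [::] power_states p].

Lemma index_power P :
  index (filter P frontiers) power_states < (size power_states).-1.+1.
Proof. by rewrite prednK ?size_subseqs_gt0 // index_mem filter_subseqs. Qed.

Lemma power_aut_accepts w : word_accepts power_aut w =
  has (accepts_from n init_table delta_table frontiers ^~ (map ys w)) power_init.
Proof.
rewrite -powerstep_accepts /word_accepts inE; congr (_ \in _).
have nthE P : nth [::] power_states (@inord (size power_states).-1
    (index (filter P frontiers) power_states)) = filter P frontiers.
  by rewrite inordK ?index_power // nth_index // filter_subseqs.
rewrite /= -[power_init in RHS]nthE -/power_init.
elim: w (inord _) => //= a w IH p; rewrite IH; congr foldl.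
exact: nthE.
Qed.

End Powerset.

Lemma code_seq_map T U (c : U -> sexp) (f : T -> U) s :
  code_seq c (map f s) = code_seq (fun x => c (f x)) s.
Proof. by elim: s => //= x s ->. Qed.

Lemma eq_code_seq T (c d : T -> sexp) s : c =1 d -> code_seq c s = code_seq d s.
Proof. by move=> E; elim: s => //= x s ->; rewrite E. Qed.

Lemma code_allpairs T U V (c : V -> sexp) (d : T -> U -> sexp) (f : T -> U -> V) s t :
  (forall x y, d x y = c (f x y)) ->
  code_seq id [seq d x y | x <- s, y <- t] = code_seq c [seq f x y | x <- s, y <- t].
Proof.
by move=> E; rewrite -[RHS](code_seq_map id c) map_allpairs; congr code_seq; apply: eq_allpairs.
Qed.

Lemma val_enum_set_ord n (P : pred nat) :
  map val (enum [set p : 'I_n | P p]) = [seq p <- iota 0 n | P p].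
Proof.
rewrite -val_enum_ord filter_map; congr map.
by rewrite {1}/enum_mem -enumT; apply: eq_filter => p; rewrite /= inE.
Qed.

Lemma code_fin_ord n (p : 'I_n) : code_fin p = code_nat p.
Proof. by rewrite /code_fin enum_rank_ord. Qed.

(** Links the automaton, about which recognition is proved, with [power_tables], which is computed
    from plain data. *)
Lemma code_power_aut n K A (G : finType) ys (T : Type) {eT : Enc T} (num : G -> T)
    (ls : seq G) (c : G -> sexp) : (forall a, enc (num a) = c a) ->
  code_word_aut ls c (power_aut n K A ys) =
  enc (power_tables n K A [seq (num a, ys a) | a <- ls]).
Proof.
move=> numE; rewrite /code_word_aut /power_tables.
set N := power_states n K A; have N0 : (size N).-1.+1 = size N.
  by rewrite prednK ?size_subseqs_gt0.
congr Cons; first by rewrite card_ord N0.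
congr Cons; first by rewrite code_fin_ord inordK // index_power.
congr Cons.
  rewrite -[in RHS]N0 -val_enum_ord allpairs_mapl allpairs_mapr.
  apply: code_allpairs => p a /=.
  by rewrite !code_fin_ord inordK ?index_power // -numE.
rewrite -[in RHS]N0 -val_enum_set_ord /enc /enc_seq code_seq_map.
by apply: eq_code_seq => p; rewrite code_fin_ord.
Qed.

Section TreeTables.
Variables (L : finType) (T : eqType) (num : L -> T) (ls : seq L) (M : tree_aut L).

Definition tables_of : tree_tables T :=
  (#|ta_state M|, ([seq (num a, rank (ta_init M a)) | a <- ls],
   ([seq (num a, (rank pq.1, (rank pq.2, (rank (ta_delta a pq.1 pq.2), tt))))
    | a <- ls, pq <- [seq (p, q) | p <- enum (ta_state M), q <- enum (ta_state M)]],
    [seq rank q | q <- enum (ta_final M)]))).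

Lemma code_tables_of {eT : Enc T} (c : L -> sexp) : (forall a, enc (num a) = c a) ->
  code_tree_aut ls c M = enc tables_of.
Proof.
move=> numE; rewrite /code_tree_aut /tables_of; congr Cons; congr Cons.
  by rewrite /= /enc /enc_seq code_seq_map; apply: eq_code_seq => a; rewrite -numE.
congr Cons; last by rewrite /= /enc /enc_seq code_seq_map; apply: eq_code_seq.
by apply: code_allpairs => a [p q] /=; rewrite -numE.
Qed.

End TreeTables.

(** * Correctness of the tables of a tree automaton *)

Section TablesCorrect.
Variables (L : finType) (num : L -> seq (option nat)) (ls : seq L) (M : tree_aut L).
Hypotheses (num_inj : injective num) (mem_ls : forall a, a \in ls).

Lemma rank_inj (T : finType) : injective (@rank T).
Proof. by move=> x y /val_inj/enum_rank_inj. Qed.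

Lemma init_tableE a : init_table (tables_of num ls M) (num a) = rank (ta_init M a).
Proof.
apply: lookupP; first by apply/mapP; exists a.
by move=> _ /mapP[b _ ->] /= /num_inj ->.
Qed.

Lemma delta_tableE a (p q : ta_state M) :
  delta_table (tables_of num ls M) (num a) (rank p) (rank q) = rank (ta_delta a p q).
Proof.
apply: lookupP.
  apply/mapP; exists (num a, (rank p, (rank q, (rank (ta_delta a p q), tt)))) => //.
  apply/allpairsP; exists (a, (p, q)); split=> //=.
  by apply/allpairsP; exists (p, q); rewrite !mem_enum.
by move=> _ /mapP[_ /allpairsP[[b [p' q']] [_ _ ->]] ->] /= [/num_inj -> /rank_inj -> /rank_inj ->].
Qed.

End TablesCorrect.

(** * Correctness of the powerset automaton *)

Section Recognition.
Variables (S L : finType) (n K : nat) (xs : L -> seq (option S)) (M : tree_aut L).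
Variable ls : seq L.
Hypothesis n_gt0 : 0 < n.
Hypothesis K_gt0 : 0 < K.
Hypothesis size_xs : forall l, size (xs l) = n.
Hypothesis xs_surj : forall x, size x = n -> has isSome x -> exists l, xs l = x.
Hypothesis xs_inj : injective xs.
Hypothesis mem_ls : forall l, l \in ls.

Definition letter_ranks (l : L) := map (omap (@rank S)) (xs l).
Let A := tables_of letter_ranks ls M.

Lemma letter_ranks_inj : injective letter_ranks.
Proof.
by apply: inj_comp xs_inj; apply/inj_map/inj_omap/rank_inj.
Qed.

(** Combines soundness and completeness of runs for a forest with a single node that is present in
    all components. *)
Lemma power_init_accepts w :
  all (fun ys => (size ys == n) &&
    all (fun l => (size l <= K) && all (fun a => a.1 < #|S|) l) ys) w ->
  has (accepts_from n (init_table A) (delta_table A) (frontiers n K A) ^~ w) (power_init n K A)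
  <-> exists s ts, [/\ size ts = n, convolves xs (map Some ts) s, tree_accepts M s
        & matches n w [:: (s, map Some ts)]].
Proof.
move=> bw.
have initE := init_tableE M letter_ranks_inj mem_ls.
have deltaE := delta_tableE letter_ranks_inj mem_ls (M:=M).
have bK : all (fun ys => (size ys == n) && all (fun l => size l <= K) ys) w.
  by apply: sub_all bw => ys /andP[-> /=]; apply: sub_all => l /andP[].
have bS : all (fun ys => (size ys == n) && all (all (fun a => a.1 < #|S|)) ys) w.
  by apply: sub_all bw => ys /andP[-> /=]; apply: sub_all => l /andP[].
split.
  case/hasP => z; rewrite mem_filter => /andP[/mapP[_ /mapP[q qF ->] ->] _].
  case/(accepts_from_sound size_xs xs_surj initE deltaE bS) => phi [Vp Ez Hw].
  case: phi Vp Ez Hw => [|[s os] [|//]] //= [Vs _] [Eos Eq] Hw.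
  have so : size os = n by rewrite -(size_map isSome) Eos size_nseq.
  exists s, (pmap id os).
  (* The mask of the root is true everywhere, so no component is absent. *)
  have Eo : map Some (pmap id os) = os.
    by elim: (os) (n) Eos => //= o os' IH [|m] //= [+ /IH E]; case: o => //= ? _; rewrite E.
  rewrite Eo; split=> //; first by rewrite -(size_map Some) Eo.
  by rewrite /tree_accepts (rank_inj Eq) -mem_enum.
move=> [s [ts [sts Cs As Hw]]]; apply/hasP.
exists [:: (nseq n true, rank (tree_run M s))].
  rewrite mem_filter mem_frontiers /= size_nseq eqxx ltn_ord muln_gt0 n_gt0 K_gt0 !andbT.
  by apply: map_f; apply: map_f; rewrite mem_enum.
have := accepts_from_complete size_xs initE deltaE (mem_frontiers n K A)
  (phi := [:: (s, map Some ts)]) _ Hw bK.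
rewrite /= /node_frontier /= -map_comp (_ : map _ ts = nseq n true); first by apply.
by rewrite -sts; elim: (ts) => //= ? ? ->.
Qed.

End Recognition.

(** * Encoding trees by words *)

Section IsConv.
Variable S : finType.

Definition olabel (u : seq bool) (o : option (tree S)) : option S :=
  obind (fun t => label t u) o.

Lemma olabel_nil : olabel [::] =1 @oroot S.
Proof. by case=> [[]|]. Qed.

Lemma olabel_cons b u o :
  olabel (b :: u) o = olabel u (if b then oright o else oleft o).
Proof. by case: b; case: o => [[]|]. Qed.

(** Connects the recursive notion with the one given by labels. Whether the root is a leaf is read
    off at the address [[:: false]], which is present exactly when some component branches. *)
Lemma convolves_label (L : finType) (xs : L -> seq (option S)) os s :
  convolves xs os s <-> forall u, omap xs (label s u) =
    if has (fun o => isSome (olabel u o)) os then Some (map (olabel u) os) else None.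
Proof.
have ol_has f u b : f =1 (if b then @oright S else @oleft S) ->
    has (fun o => isSome (olabel (b :: u) o)) =1
      (fun os => has (fun o => isSome (olabel u o)) (map f os)).
  by move=> Ef os'; rewrite has_map; apply: eq_has => o /=; rewrite olabel_cons Ef; case: b {Ef}.
have ol_map f u b : f =1 (if b then @oright S else @oleft S) ->
    map (olabel (b :: u)) =1 (fun os => map (olabel u) (map f os)).
  by move=> Ef os'; rewrite -map_comp; apply: eq_map => o /=; rewrite olabel_cons Ef; case: b {Ef}.
have has0 os' : has (fun o => isSome (olabel [::] o)) os' = has isSome os'.
  by apply: eq_has => -[[]|].
have hasf os' : has (fun o => isSome (olabel [:: false] o)) os' = has (@onode S) os'.
  by apply: eq_has => -[[|? [] ?]|].
elim: s os => [x|x l IHl r IHr] os /=; split.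
- case=> Ex so no [|b u] /=.
    by rewrite has0 so Ex (eq_map olabel_nil).
  case: ifP => // /(has_nthP None)[j lt H]; case/negP: no.
  apply/(has_nthP None); exists j => //.
  by case: (nth None os j) H => [[]|].
- move=> H; have := H [::]; rewrite has0 (eq_map olabel_nil) /=; case: ifP => // so [Ex].
  by split=> //; have := H [:: false]; rewrite hasf; case: ifP.
- case=> Ex no /IHl Hl /IHr Hr [|b u] /=.
    rewrite has0 (eq_map olabel_nil) Ex ifT //; apply: sub_has no; by case.
  by case: b; [rewrite Hr (ol_has (@oright S)) ?(ol_map (@oright S))
              |rewrite Hl (ol_has (@oleft S)) ?(ol_map (@oleft S))].
- move=> H; have := H [::]; rewrite has0 (eq_map olabel_nil) /=; case: ifP => // so [Ex].
  split=> //.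
  + by have := H [:: false]; rewrite hasf; case: ifP => //; case: (l).
  + by apply/IHl => u; have := H (false :: u); rewrite /= (ol_has (@oleft S)) ?(ol_map (@oleft S)).
  + by apply/IHr => u; have := H (true :: u); rewrite /= (ol_has (@oright S)) ?(ol_map (@oright S)).
Qed.

Lemma convolves_is_conv n (ts : n.-tuple (tree S)) s :
  convolves val (map Some ts) s <-> is_conv ts s.
Proof.
apply: (iff_trans (convolves_label _ _ _)); split=> H u; have := H u; rewrite has_map -map_comp.
  rewrite (eq_has (a2 := fun t => label t u : bool)) //.
  case: ifP => _; case: (label s u) => //= x [Ex]; congr Some.
  by apply: val_inj.
by move=> ->; case: ifP.
Qed.

Lemma convolves1 (t s : tree S) : convolves (fun a => [:: Some a]) [:: Some t] s <-> s = t.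
Proof.
elim: s t => [a|a l IHl r IHr] [b|b l' r'] /=.
- by split=> [[[->]]|[->]].
- by split=> [[]|].
- by split=> [[]|].
- split=> [[[->] _ Cl Cr]|[-> <- <-]]; last by split=> //; [apply/IHl | apply/IHr].
  by rewrite (proj1 (IHl _) Cl) (proj1 (IHr _) Cr).
Qed.

(** At an address of the convolution its letter shows the labels of all components; at any other
    address all components are undefined. *)
Lemma is_conv_inj n (ts us : n.-tuple (tree S)) s : is_conv ts s -> is_conv us s -> ts = us.
Proof.
move=> Ht Hu; apply: eq_from_tnth => j; apply: label_inj => u.
have mem1 (vs : n.-tuple (tree S)) : has (fun t => label t u : bool) vs = false ->
    label (tnth vs j) u = None.
  case E: (label (tnth vs j) u) => [a|//] /negP[]; apply/(has_nthP (tnth vs j)).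
  by exists j; rewrite ?size_tuple // -tnth_nth E.
have := Ht u; rewrite Hu; case: ifP => [_|/mem1->]; case: ifP => [_|/mem1->] //.
move=> [/(congr1 (fun r => nth None r j))].
by rewrite !(nth_map (tnth ts j)) ?size_tuple // -!tnth_nth.
Qed.

End IsConv.

(* The empty level is removed because it represents padding. *)
Definition level_list (s K : nat) : seq (seq (nat * bool)) :=
  behead (words_upto [seq (a, b) | a <- iota 0 s, b <- [:: false; true]] K).

Lemma mem_level_list s K l : (l \in level_list s K) =
  [&& l != [::], size l <= K & all (fun a => a.1 < s) l].
Proof.
have := mem_words_upto [seq (a, b) | a <- iota 0 s, b <- [:: false; true]] K l.
have := @uniq_words_upto _ [seq (a, b) | a <- iota 0 s, b <- [:: false; true]] K.
rewrite words_upto_behead -/(level_list s K) inE /= => Un.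
have -> : all (mem [seq (a, b) | a <- iota 0 s, b <- [:: false; true]]) l =
    all (fun a => a.1 < s) l.
  apply: eq_all => -[a b]; apply/allpairsP/idP => [[[a' b'] /= []]|lt].
    by rewrite mem_iota => lt _ [-> _].
  by exists (a, b); rewrite mem_iota; case: (b).
case: eqP => [->|//] _ /=; apply/negbTE.
have /Un /andP[] // : uniq [seq (a, b) | a <- iota 0 s, b <- [:: false; true]].
by apply: allpairs_uniq => //; [apply: iota_uniq | move=> [? ?] [? ?]].
Qed.

Lemma uniq_level_list s K : uniq (level_list s K).
Proof.
have : uniq (words_upto [seq (a, b) | a <- iota 0 s, b <- [:: false; true]] K).
  apply: uniq_words_upto; apply: allpairs_uniq => //; first exact: iota_uniq.
  by move=> [? ?] [? ?].
by rewrite words_upto_behead => /andP[].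
Qed.

Section Encoding.
Variables (S : finType) (K : nat).
Notation lv := (level_list #|S| K).
Notation G := 'I_(size lv).
Implicit Types (t : tree S) (w : seq G).

Definition level_of (i : G) : seq (nat * bool) := nth [::] lv i.
Definition padded_level (o : option G) : seq (nat * bool) := oapp level_of [::] o.

(* Levels that are too wide have no letter and are dropped. *)
Definition encode t : seq G := pmap insub [seq index l lv | l <- levels t].

Definition narrow t : Prop := forall k, width t k <= K.

Lemma level_of_inj : injective level_of.
Proof.
move=> i j /eqP; rewrite nth_uniq ?uniq_level_list // => /eqP; exact: val_inj.
Qed.

Lemma level_of_mem i : level_of i \in lv.
Proof. exact: mem_nth. Qed.

Lemma level_of_neq0 i : level_of i != [::].
Proof. by have := level_of_mem i; rewrite mem_level_list => /and3P[]. Qed.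

Lemma narrow_levels t : narrow t -> {subset levels t <= lv}.
Proof.
move=> nt l lt; rewrite mem_level_list.
rewrite (allP (levels_nonempty t)) // (allP (levels_ranks t)) // andbT /=.
by rewrite -(nth_index [::] lt) size_levels.
Qed.

Lemma levels_encode t : {subset levels t <= lv} -> map level_of (encode t) = levels t.
Proof.
rewrite /encode; elim: (levels t) => //= l s IH sub.
have ls : l \in lv by apply: sub; rewrite mem_head.
rewrite insubT ?index_mem // => lt /=; rewrite IH; last first.
  by move=> x xs; apply: sub; rewrite inE xs orbT.
by rewrite /level_of /= nth_index.
Qed.

(** Each level of [t] is that of a letter of [w], which is what [levels_encode] asks for. *)
Lemma encode_eq w t : map level_of w = levels t -> encode t = w.
Proof.
move=> E; apply: (inj_map level_of_inj); rewrite E levels_encode // => l.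
by rewrite -E => /mapP[i _ ->]; apply: level_of_mem.
Qed.

Lemma encode_inj t u : narrow t -> narrow u -> encode t = encode u -> t = u.
Proof.
move=> /narrow_levels/levels_encode Et /narrow_levels/levels_encode Eu E.
by apply: levels_inj; rewrite -Et -Eu E.
Qed.

Lemma matches_domain (L : finType) (s : tree L) t w :
  matches 1 [seq [:: level_of i] | i <- w] [:: (s, [:: Some t])] <-> map level_of w = levels t.
Proof.
have E k : nth [::] (nth [::] [seq [:: level_of i] | i <- w] k) 0 = nth [::] (map level_of w) k.
  by elim: w k => [|i w IH] [|k] /=; rewrite ?nth_nil.
rewrite /matches big_ord1 size_map /= zipcats0; split=> [[sz H]|Ew].
  by apply: (@eq_from_nth _ [::]); rewrite size_map // => k _; rewrite -E H //= zipcats0.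
split; first by rewrite -Ew size_map.
by case=> // _ k; rewrite E Ew /= zipcats0.
Qed.

Lemma nth_padded_level w k : nth [::] (map level_of w) k = padded_level (onth w k).
Proof. by elim: w k => [|i w IH] [|k] //=; rewrite -?IH ?nth_nil. Qed.

Lemma padded_level_inj : injective padded_level.
Proof.
case=> [i|] [j|] //= E; first by rewrite (level_of_inj E).
  by have := level_of_neq0 i; rewrite E.
by have := level_of_neq0 j; rewrite -E.
Qed.

(** The padding of the word convolution corresponds to the empty levels beyond the height of a
    component, and both lengths are the maximal number of levels. *)
Lemma matches_relation n (L : finType) (s : tree L) (ts : n.-tuple (tree S))
    (w : seq (n.-tuple (option G))) :
  (forall j, narrow (tnth ts j)) ->
  matches n [seq [seq padded_level o | o <- val y] | y <- w] [:: (s, map Some ts)]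
  <-> w = word_conv [tuple of [seq encode t | t <- ts]].
Proof.
move=> nts.
have Enc j : map level_of (encode (tnth ts j)) = levels (tnth ts j).
  by apply: levels_encode; apply: narrow_levels.
have Ec (j : 'I_n) : forest_levels (component j [:: (s, map Some ts)]) = levels (tnth ts j).
  by rewrite /= (nth_map (tnth ts j)) ?size_tuple //= zipcats0 -tnth_nth.
have Em : \max_(v <- [tuple of [seq encode t | t <- ts]]) size v =
    \max_(j < n) size (forest_levels (component j [:: (s, map Some ts)])).
  rewrite big_tuple; apply: eq_bigr => j _.
  by rewrite Ec tnth_map -Enc size_map.
(* As a default letter, full padding agrees with the empty levels read beyond the end of [w]. *)
pose y0 : n.-tuple (option G) := [tuple None | _ < n].
have Ey k (j : 'I_n) :
    nth [::] (nth [::] [seq [seq padded_level o | o <- val y] | y <- w] k) j =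
    padded_level (tnth (nth y0 w k) j).
  have [lt|ge] := ltnP k (size w).
    by rewrite (nth_map y0) // (nth_map None) ?size_tuple // -tnth_nth.
  by rewrite !nth_default ?size_map // tnth_mktuple.
split=> [[sz H]|Ew].
  rewrite size_map -Em in sz.
  rewrite /word_conv; apply: (@eq_from_nth _ y0); first by rewrite size_mkseq sz.
  rewrite sz => k lt.
  rewrite nth_mkseq //; apply: eq_from_tnth => j; apply: padded_level_inj.
  by rewrite -Ey H // Ec !tnth_map -nth_padded_level Enc.
split; first by rewrite size_map Ew size_mkseq.
move=> j lt k; rewrite (Ey k (Ordinal lt)) (Ec (Ordinal lt)) -Enc nth_padded_level.
congr padded_level; rewrite Ew.
have [ltk|ge] := ltnP k (\max_(v <- [tuple of [seq encode t | t <- ts]]) size v).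
  by rewrite nth_mkseq // !tnth_map.
rewrite nth_default ?size_mkseq // tnth_mktuple onth_default //.
apply: leq_trans ge; rewrite Em -(size_map level_of) Enc -Ec.
exact: (@leq_bigmax _ (fun j : 'I_n => size (forest_levels (component j [:: (s, map Some ts)])))).
Qed.

End Encoding.

(** * Computability of the translation *)

Section Words.
Context {E : Type} {eE : Enc E} {T : eqType} {eT : Enc T}.

Lemma computable_words (s : E -> seq T) (n : E -> nat) :
  computable s -> computable n -> computable (fun e => words (s e) (n e)).
Proof. by move=> Hs Hn; rewrite /words /cons_all; comp. Qed.

Lemma computable_words_upto (s : E -> seq T) (n : E -> nat) :
  computable s -> computable n -> computable (fun e => words_upto (s e) (n e)).
Proof. by move=> Hs Hn; rewrite /words_upto /cons_all; comp. Qed.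

Lemma computable_subseqs (s : E -> seq T) :
  computable s -> computable (fun e => subseqs (s e)).
Proof. by move=> Hs; rewrite /subseqs; comp. Qed.

Lemma computable_lookup {cT : CEq T} (x : E -> T) (s : E -> seq (T * nat)) :
  computable x -> computable s -> computable (fun e => lookup (x e) (s e)).
Proof. by move=> Hx Hs; rewrite /lookup; comp. Qed.

End Words.

Ltac comp_words ::= lazymatch goal with
  | |- computable (fun e => words _ _) => refine (computable_words _ _)
  | |- computable (fun e => words_upto _ _) => refine (computable_words_upto _ _)
  | |- computable (fun e => subseqs _) => refine (computable_subseqs _)
  | |- computable (fun e => lookup _ _) => refine (computable_lookup _ _)
  end.

Notation word := (seq (option nat)).
#[global] Instance enc_frontier : Enc frontier := enc_seq (enc_pair (enc_seq enc_bool) enc_nat).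
#[global] Instance enc_tree_tables T (eT : Enc T) : Enc (tree_tables T) :=
  enc_pair enc_nat (enc_pair (enc_seq (enc_pair eT enc_nat))
    (enc_pair (enc_seq (enc_pair eT
        (enc_pair enc_nat (enc_pair enc_nat (enc_pair enc_nat enc_unit)))))
      (enc_seq enc_nat))).
#[global] Instance enc_word_tables T (eT : Enc T) : Enc (word_tables T) :=
  enc_pair enc_nat (enc_pair enc_nat
    (enc_pair (enc_seq (enc_pair enc_nat (enc_pair eT (enc_pair enc_nat enc_unit))))
      (enc_seq enc_nat))).

Section Tables.
Context {E : Type} {eE : Enc E}.
Variables (n K : E -> nat) (A : E -> tree_tables word).
Hypotheses (Hn : computable n) (HK : computable K) (HA : computable A).

Lemma computable_init_table (x : E -> word) :
  computable x -> computable (fun e => init_table (A e) (x e)).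
Proof. by move=> Hx; rewrite /init_table; comp. Qed.

Lemma computable_delta_table (x : E -> word) (p q : E -> nat) :
  computable x -> computable p -> computable q ->
  computable (fun e => delta_table (A e) (x e) (p e) (q e)).
Proof. by move=> Hx Hp Hq; rewrite /delta_table; comp. Qed.

Lemma computable_frontiers : computable (fun e => frontiers (n e) (K e) (A e)).
Proof. by rewrite /frontiers; comp. Qed.

Lemma computable_letter (m : E -> seq bool) (ys : E -> seq (seq (nat * bool))) :
  computable m -> computable ys -> computable (fun e => letter (n e) (m e) (ys e)).
Proof. by move=> Hm Hy; rewrite /letter /entry /omap /obind; comp. Qed.

Lemma computable_node_bits (m : E -> seq bool) (ys : E -> seq (seq (nat * bool))) :
  computable m -> computable ys -> computable (fun e => node_bits (n e) (m e) (ys e)).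
Proof. by move=> Hm Hy; rewrite /node_bits /entry; comp. Qed.

Lemma computable_rest (m : E -> seq bool) (ys : E -> seq (seq (nat * bool))) :
  computable m -> computable ys -> computable (fun e => rest (n e) (m e) (ys e)).
Proof. by move=> Hm Hy; rewrite /rest; comp. Qed.

End Tables.

Lemma computable_isSome E T {eE : Enc E} {eT : Enc T} (o : E -> option T) :
  computable o -> computable (fun e => isSome (o e)).
Proof.
move=> Ho; apply: (@computable_ext _ _ _ _ _ (fun e => oapp (fun=> true) false (o e))).
  by move=> e; case: (o e).
by comp.
Qed.

Ltac comp_tables ::= lazymatch goal with
  | |- computable (fun e => init_table _ _) => refine (computable_init_table _ _)
  | |- computable (fun e => delta_table _ _ _ _) => refine (computable_delta_table _ _ _ _)
  | |- computable (fun e => frontiers _ _ _) => refine (computable_frontiers _ _ _)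
  | |- computable (fun e => letter _ _ _) => refine (computable_letter _ _ _)
  | |- computable (fun e => node_bits _ _ _) => refine (computable_node_bits _ _ _)
  | |- computable (fun e => rest _ _ _) => refine (computable_rest _ _ _)
  | |- computable (fun e => isSome _) => refine (computable_isSome _)
  end.

Section Translation.
Context {E : Type} {eE : Enc E}.
Variables (n K : E -> nat) (A : E -> tree_tables word).
Hypotheses (Hn : computable n) (HK : computable K) (HA : computable A).

Lemma computable_consume (a : E -> option (seq (seq (nat * bool)) * frontier))
    (b : E -> seq bool * nat) : computable a -> computable b ->
  computable (fun e => consume (n e) (init_table (A e)) (delta_table (A e)) (a e) (b e)).
Proof. by move=> Ha Hb; rewrite /consume; comp. Qed.

End Translation.

Lemma computable_power_delta E {eE : Enc E} (n K : E -> nat) (A : E -> tree_tables word)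
    (X : E -> seq frontier) (ys : E -> seq (seq (nat * bool))) :
  computable n -> computable K -> computable A -> computable X -> computable ys ->
  computable (fun e => power_delta (n e) (K e) (A e) (X e) (ys e)).
Proof.
move=> Hn HK HA HX Hy; rewrite /power_delta /powerstep /trans; comp.
by refine (computable_consume _ _ _ _); comp.
Qed.

Lemma computable_power_states E {eE : Enc E} (n K : E -> nat) (A : E -> tree_tables word) :
  computable n -> computable K -> computable A ->
  computable (fun e => power_states (n e) (K e) (A e)).
Proof. by move=> Hn HK HA; rewrite /power_states; comp. Qed.

Ltac comp_power ::= lazymatch goal with
  | |- computable (fun e => power_delta _ _ _ _ _) => refine (computable_power_delta _ _ _ _ _)
  | |- computable (fun e => power_states _ _ _) => refine (computable_power_states _ _ _)
  end.

Lemma computable_power_tables E T {eE : Enc E} {eT : Enc T} (n K : E -> nat)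
    (A : E -> tree_tables word) (ls : E -> seq (T * seq (seq (nat * bool)))) :
  computable n -> computable K -> computable A -> computable ls ->
  computable (fun e => power_tables (n e) (K e) (A e) (ls e)).
Proof.
by move=> Hn HK HA Hls; rewrite /power_tables /power_init; comp.
Qed.

(** Letters become tuples of length one, so that the domain is handled as a unary relation. *)
Definition wrap_tables (A : tree_tables nat) : tree_tables word :=
  (A.1, ([seq ([:: Some r.1], r.2) | r <- A.2.1],
         ([seq ([:: Some r.1], r.2) | r <- A.2.2.1], A.2.2.2))).

Definition tree_pres_tables : Type :=
  nat * (tree_tables nat * seq (nat * tree_tables word)).
Definition word_pres_tables : Type :=
  nat * (word_tables nat * seq (nat * word_tables word)).

Definition domain_letters (lv : seq (seq (nat * bool))) :
    seq (nat * seq (seq (nat * bool))) :=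
  [seq (i, [:: nth [::] lv i]) | i <- iota 0 (size lv)].

Definition relation_letters (lv : seq (seq (nat * bool))) (n : nat) :
    seq (word * seq (seq (nat * bool))) :=
  [seq (x, [seq oapp (nth [::] lv) [::] o | o <- x])
  | x <- words (None :: map Some (iota 0 (size lv))) n].

Definition translate_with (K : nat) (lv : seq (seq (nat * bool)))
    (P : tree_pres_tables) : word_pres_tables :=
  (size lv, (power_tables 1 K (wrap_tables P.2.1) (domain_letters lv),
    [seq (r.1, power_tables r.1 K r.2 (relation_letters lv r.1)) | r <- P.2.2])).

(** Here [P.1] is the size of the alphabet and [P.2.1.1] the number of states of the domain
    automaton, so [4 ^ P.2.1.1] is the width bound of [slim_width]. *)
Definition translate (P : tree_pres_tables) : word_pres_tables :=
  translate_with (4 ^ P.2.1.1) (level_list P.1 (4 ^ P.2.1.1)) P.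

#[global] Instance enc_tree_pres_tables : Enc tree_pres_tables :=
  enc_pair enc_nat (enc_pair (enc_tree_tables enc_nat)
    (enc_seq (enc_pair enc_nat (enc_tree_tables (enc_seq (enc_option enc_nat)))))).
#[global] Instance enc_word_pres_tables : Enc word_pres_tables :=
  enc_pair enc_nat (enc_pair (enc_word_tables enc_nat)
    (enc_seq (enc_pair enc_nat (enc_word_tables (enc_seq (enc_option enc_nat)))))).

Lemma computable_wrap_tables E {eE : Enc E} (A : E -> tree_tables nat) :
  computable A -> computable (fun e => wrap_tables (A e)).
Proof. by move=> HA; rewrite /wrap_tables; comp. Qed.

Lemma computable_level_list E {eE : Enc E} (s K : E -> nat) :
  computable s -> computable K -> computable (fun e => level_list (s e) (K e)).
Proof. by move=> Hs HK; rewrite /level_list; comp. Qed.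

Lemma computable_exp4 E {eE : Enc E} (n : E -> nat) :
  computable n -> computable (fun e => 4 ^ n e).
Proof.
move=> Hn; apply: (@computable_ext _ _ _ _ _ (fun e => iter (n e) (fun k => 4 * k) 1)).
  by move=> e; elim: (n e) => //= m <-; rewrite expnS.
by comp.
Qed.

Lemma computable_translate : computable translate.
Proof.
rewrite /translate /translate_with /domain_letters /relation_letters; comp;
  try (refine (computable_power_tables _ _ _ _); comp);
  repeat first [apply: computable_wrap_tables; comp
    | refine (computable_level_list _ _); comp | refine (computable_exp4 _); comp].
Qed.

(** * The word automatic presentation *)

(** Both enumerations follow the same order, so the computed transition tables list the letters as
    the code of a presentation does. *)
Lemma words_tuples (T : Type) (U : eqType) (f : T -> U) (s : seq T) n :
  words (map f s) n = [seq map f (val y) | y <- tuples s n].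
Proof.
elim: n => //= n IH; rewrite IH map_allpairs /cons_all allpairs_mapl allpairs_mapr.
by apply: eq_allpairs.
Qed.

(** As S-expressions, [Some k] coincides with the number [k.+1] and [None] with 0, which is the
    convention of [code_padded]. *)
Lemma enc_letter (T : finType) n (y : n.-tuple (option T)) :
  enc (map (omap (@rank T)) (val y)) = code_letter y.
Proof. by rewrite /enc /enc_seq code_seq_map; apply: eq_code_seq; case. Qed.

Lemma rank_ord n (i : 'I_n) : rank i = i.
Proof. by rewrite /rank enum_rank_ord. Qed.

Lemma arity_gt0 (sg : signature) (i : 'I_(size sg)) : 0 < arity i.
Proof. by case: sg i => s s1 i; apply: (allP s1); apply: mem_nth. Qed.

Section Presentation.
Variables (sg : signature) (S : finType) (A : structure sg (tree S)) (P : tree_pres sg S).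
Hypotheses (PA : tree_presents P A) (slimA : slim (dom A)).

Let K := 4 ^ #|ta_state (tp_dom P)|.
Let lv := level_list #|S| K.
Let G := 'I_(size lv).

Let xs1 (a : S) : seq (option S) := [:: Some a].
Let dom_tables := tables_of (letter_ranks xs1) (enum S) (tp_dom P).
Let rel_tables i := tables_of (letter_ranks val) (letters S (arity i)) (tp_rel P i).

Definition slim_word_pres : word_pres sg G :=
  WordPres (power_aut 1 K dom_tables (fun i => [:: @level_of S K i]))
    (fun i => power_aut (arity i) K (rel_tables i)
       (fun y => [seq @padded_level S K o | o <- val y])).

Lemma K_gt0 : 0 < K. Proof. by rewrite expn_gt0. Qed.

Lemma dom_narrow t : dom A t -> narrow K t.
Proof. by move=> At k; apply: slim_width At k => //; case: PA. Qed.

Lemma rel_narrow i ts : Defs.rel A (i := i) ts -> forall j, narrow K (tnth ts j).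
Proof. by move=> /rel_dom H j; apply: dom_narrow. Qed.

Definition slim_word_structure : structure sg (seq G).
Proof.
refine (@Structure sg (seq G) (fun w => exists2 t, dom A t & w = encode K t)
  (fun i ws => exists2 ts, Defs.rel A (i := i) ts & ws = [tuple of [seq encode K t | t <- ts]]) _).
move=> i _ [ts Rts ->] j; exists (tnth ts j); first exact: rel_dom Rts j.
by rewrite tnth_map.
Defined.

Lemma level_of_bound (i : G) :
  (size (level_of i) <= K) && all (fun a => a.1 < #|S|) (level_of i).
Proof. by have := level_of_mem i; rewrite mem_level_list => /and3P[_ -> ->]. Qed.

Lemma slim_word_dom : word_recognizes (wp_dom slim_word_pres) (dom slim_word_structure).
Proof.
move=> w; rewrite /= power_aut_accepts.
have xs1_surj x : size x = 1 -> has isSome x -> exists a, xs1 a = x.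
  by case: x => [|[a|] []] // _ _; exists a.
have xs1_inj : injective xs1 by move=> a b [].
have mem_S a : a \in enum S by rewrite mem_enum.
have size1 a : size (xs1 a) = 1 by [].
have bw : all (fun ys => (size ys == 1) &&
    all (fun l => (size l <= K) && all (fun a => a.1 < #|S|) l) ys)
    [seq [:: level_of i] | i <- w].
  by apply/allP => _ /mapP[i _ ->] /=; rewrite level_of_bound.
apply: (iff_trans (power_init_accepts (tp_dom P) (isT : 0 < 1) K_gt0
  size1 xs1_surj xs1_inj mem_S bw)).
have [domP _] := PA; split=> [[s [ts [sz Cs /domP As Hw]]]|[t At ->]].
  case: ts sz Cs Hw => [|t []] // _ Cs Hw; rewrite (proj1 (convolves1 t s) Cs) in As.
  by exists t => //; rewrite (encode_eq (proj1 (matches_domain s t w) Hw)).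
exists t, [:: t]; split=> //; first exact: (proj2 (convolves1 t t)).
  exact/domP.
by apply/matches_domain/levels_encode/narrow_levels/dom_narrow.
Qed.

Lemma slim_word_rel i :
  word_recognizes (wp_rel slim_word_pres i) (word_conv_lang (@Defs.rel _ _ slim_word_structure i)).
Proof.
move=> w; rewrite /= power_aut_accepts.
have surj x : size x = arity i -> has isSome x ->
    exists y : (arity i).-tuple (option S), val y = x.
  by move=> /eqP sx _; exists (Tuple sx).
have bw : all (fun ys => (size ys == arity i) &&
    all (fun l => (size l <= K) && all (fun a => a.1 < #|S|) l) ys)
    [seq [seq @padded_level S K o | o <- val y] | y <- w].
  apply/allP => _ /mapP[y _ ->]; rewrite size_map size_tuple eqxx /=.
  by apply/allP => _ /mapP[[j|] _ ->] //=; rewrite level_of_bound.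
apply: (iff_trans (power_init_accepts (tp_rel P i) (arity_gt0 i) K_gt0
  (fun y => size_tuple y) surj val_inj (@mem_letters S (arity i)) bw)).
have [_ /(_ i) relP] := PA; split.
  move=> [s [ts [/eqP sts]]]; rewrite -[ts]/(val (Tuple sts)).
  (* The accepted tree is the convolution of a tuple in the relation. A convolution determines its
     tuple, so [ts] is in the relation and its trees are narrow. *)
  move=> /convolves_is_conv Cs /relP[us Rus Cu]; rewrite (is_conv_inj Cs Cu).
  move=> /(matches_relation _ _ (rel_narrow Rus)) Ew.
  by exists [tuple of [seq encode K t | t <- us]] => //; exists us.
move=> [_ [ts Rts ->] Ew].
have [s Cs] := conv_exists ts (arity_gt0 i).
exists s, ts; split; first exact: size_tuple.
- exact/convolves_is_conv.
- by apply/relP; exists ts.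
- exact/(matches_relation _ _ (rel_narrow Rts)).
Qed.

Lemma slim_iso : iso A slim_word_structure.
Proof.
exists (encode K); split.
- by move=> t At; exists t.
- by move=> t u /dom_narrow At /dom_narrow Au; apply: encode_inj.
- by move=> _ [t At ->]; exists t.
move=> i ts Dts; split=> [Rts|[us Rus Eus]]; first by exists ts.
suff -> : ts = us by [].
apply: eq_from_tnth => j; apply: (@encode_inj _ K).
- exact: dom_narrow.
- exact: rel_narrow Rus j.
by have := congr1 (fun v => tnth v j) Eus; rewrite !tnth_map.
Qed.

Definition pres_tables : tree_pres_tables :=
  (#|S|, (tables_of (@rank S) (enum S) (tp_dom P),
    [seq (arity i, rel_tables i) | i <- enum 'I_(size sg)])).

Lemma code_pres_tables : code_tree_pres P = enc pres_tables.
Proof.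
rewrite /code_tree_pres; congr Cons; congr Cons; first exact: code_tables_of.
rewrite /= /enc /enc_seq code_seq_map; apply: eq_code_seq => i; congr Cons.
by apply: code_tables_of => y; apply: enc_letter.
Qed.

Lemma wrap_dom_tables : wrap_tables (tables_of (@rank S) (enum S) (tp_dom P)) = dom_tables.
Proof.
rewrite /wrap_tables /dom_tables /tables_of /=; congr (_, (_, (_, _))).
  by rewrite -map_comp.
by rewrite map_allpairs.
Qed.

(** The letters of the word alphabet are positions in [lv] and hence equal to their ranks, so both
    sides list and code them alike. *)
Lemma code_slim_word_pres : code_word_pres slim_word_pres = enc (translate pres_tables).
Proof.
rewrite /code_word_pres; congr Cons; first by rewrite card_ord.
congr Cons.
  rewrite /= wrap_dom_tables (code_power_aut _ _ _ _ _ (num := val)).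
    congr (enc (power_tables _ _ _ _)).
    by rewrite /domain_letters -val_enum_ord -map_comp.
  by move=> i; rewrite code_fin_ord.
rewrite /= /enc /enc_seq -map_comp code_seq_map; apply: eq_code_seq => i; congr Cons.
rewrite (code_power_aut _ _ _ _ _ (num := fun y => map (omap (@rank G)) (val y))).
  congr (enc (power_tables _ _ _ _)).
  rewrite /relation_letters -val_enum_ord -map_comp.
  have -> : None :: [seq (Some \o val) j | j <- enum G] =
      map (omap (@rank G)) (None :: map Some (enum G)).
    by rewrite /= -map_comp; congr cons; apply: eq_map => j /=; rewrite rank_ord.
  rewrite words_tuples -map_comp; apply: eq_map => y /=; congr (_, _).
  by rewrite -map_comp; apply: eq_map => -[j|] //=; rewrite rank_ord.
by move=> y; apply: enc_letter.
Qed.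

End Presentation.

Theorem theorem4p1 :
  (forall (sg : signature) (S : finType) (A : structure sg (tree S)),
     tree_automatic A -> slim (dom A) -> word_automatic A)
  /\
  exists p : prog,
    forall (sg : signature) (S : finType) (A : structure sg (tree S))
           (P : tree_pres sg S),
      tree_presents P A -> slim (dom A) ->
      exists (G : finType) (W : word_pres sg G),
        eval p (code_tree_pres P) (code_word_pres W) /\
        exists B : structure sg (seq G), word_presents W B /\ iso A B.
Proof.
(* There are finitely many relations, so automata for all of them can be chosen at once and form a
   presentation. *)
split=> [sg S A [[M domM] /fin_all_exists[N relN]] slimA|].
  have PA : tree_presents (TreePres M N) A by [].
  exists _, (slim_word_structure A (TreePres M N)); split; last exact: slim_iso.
  split; first by exists (wp_dom (slim_word_pres (TreePres M N))); apply: slim_word_dom.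
  by move=> i; exists (wp_rel (slim_word_pres (TreePres M N)) i); apply: slim_word_rel.
(* [translate] is a single function for all signatures and alphabets, which makes the program
   uniform. *)
have [p pP] := computable_translate.
exists p => sg S A P PA slimA; exists _, (slim_word_pres P); split.
  rewrite code_pres_tables code_slim_word_pres; exact: pP.
exists (slim_word_structure A P); split; last exact: slim_iso.
by split; [apply: slim_word_dom | move=> i; apply: slim_word_rel].
Qed.
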